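(* Consider the robust tie-line scheduling problem $$\min_{y\in\mathcal{Y}}\Big(\max_{\xi_1\in\Xi_1}J_1^*(y,\xi_1)+\max_{\xi_2\in\Xi_2}J_2^*(y,\xi_2)\Big).$$ Provided the step size $\varepsilon>0$ in the inner critical region exploration algorithm is sufficiently small, the robust scheduling algorithm (both described in the context) terminates after finitely many steps, and the point $y^*$ held at termination is an optimal solution of the robust tie-line scheduling problem.
   Context: **Two-area power system model.** For $i=1,2$, area $i$ has $n_i$ internal buses and $\overline{n}_i$ boundary buses. Let $g_i,w_i,d_i,\theta_i\in\mathbf{R}^{n_i}$ (dispatchable generation, renewable generation, controllable load, phase angles at internal buses) and $\overline{\theta}_i\in\mathbf{R}^{\overline{n}_i}$ (phase angles at boundary buses). Write $x_i=(g_i,w_i,d_i,\theta_i)$, $\xi_i=(\overline{W}_i,\underline{D}_i,\overline{D}_i)\in\mathbf{R}^{3n_i}$, $y=(\overline{\theta}_1,\overline{\theta}_2)\in\mathbf{R}^{\overline{n}_1+\overline{n}_2}$. With given constant real matrices and vectors, the constraints of area $1$ are - power flow: $B_{11}\theta_1+B_{1\bar1}\overline{\theta}_1=g_1+w_1-d_1$ and $B_{\bar11}\theta_1+B_{\bar1\bar1}\overline{\theta}_1+B_{\bar1\bar2}\overline{\theta}_2=0$; - asset limits: $\underline{G}_1\le g_1\le\overline{G}_1$, $0\le w_1\le\overline{W}_1$, $\underline{D}_1\le d_1\le\overline{D}_1$ (elementwise); - line limits: $H_1\theta_1+\overline{H}_1\overline{\theta}_1\le f_1$; and symmetrically for area $2$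 (indices $1$ and $2$ swapped). These are written jointly (equalities as pairs of inequalities) as a system of $m_i$ linear inequalities $A_i^x x_i+A_i^\xi\xi_i+A_i^y y\le b_i$. The tie-line constraints $\overline{H}_{12}\overline{\theta}_1+\overline{H}_{21}\overline{\theta}_2\le f_{12}$ (together with the slack-bus convention that the phase angle of one designated boundary bus in area 1 is zero, and bounds on phase angles) are written $y\in\mathcal{Y}$, where $\mathcal{Y}$ is a nonempty polytope in $\mathbf{R}^{\overline{n}_1+\overline{n}_2}$. The dispatch cost of area $i$ is $$[P_i^g]^\top g_i+[P_i^w]^\top(\overline{W}_i-w_i)+[P_i^d]^\top(\overline{D}_i-d_i)=:c_i(x_i,\xi_i)=c_i^0+[c_i^x]^\top x_i+[c_i^\xi]^\top\xi_i .$$ The uncertainty set is the box $\Xi_i=\{\xi_i\in\mathbf{R}^{3n_i}:\xi_i^{\mathsf L}\le\xi_i\le\xi_i^{\mathsf U}\}$, with given $\xi_i^{\mathsf L}\le\xi_i^{\mathsf U}$. Define $J_i^*(y,\xi_i):=\min_{x_i}\{c_i(x_i,\xi_i): A_i^x x_i+A_i^\xi\xi_i+A_i^y y\le b_i\}$. Standing assumption: this linear program is feasible for each $y\in\mathcal{Y}$ and $\xi_i\in\Xi_i$. **Critical region exploration algorithm** for minimizing $F=F_1+F_2$ over $\mathcal{Y}$, where each $F_i:\mathcal{Y}\to\mathbf{R}$ is convex and piecewise affine (step size $\varepsilon>0$). For each $i$ fix a finite family of polytopes (each of the same dimension as $\mathcal{Y}$), intersecting only at their boundaries and with union $\mathcal{Y}$,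 on each of which $F_i$ is affine with a fixed affine description (the critical regions of $F_i$). For $y\in\mathcal{Y}$ let $\mathcal{P}_i^y$ be a critical region of $F_i$ containing $y$ (any one of them if there are several), with $F_i(z)=[\alpha_i^y]^\top z+\beta_i^y$ on $\mathcal{P}_i^y$; put $\mathcal{P}^y=\mathcal{P}_1^y\cap\mathcal{P}_2^y$, $\alpha^y=\alpha_1^y+\alpha_2^y$, $\beta^y=\beta_1^y+\beta_2^y$. Initialize $y$ any point in $\mathcal{Y}$, $J^*\gets\infty$, $\mathcal{D}\gets\emptyset$. Repeat: (1) minimize $[\alpha^y]^\top z+\beta^y$ over $z\in\mathcal{P}^y$, with lexicographically smallest minimizer $y^{\mathrm{opt}}$ and optimal value $J^{\mathrm{opt}}$; (2) if $J^{\mathrm{opt}}<J^*$, set $y^*\gets y^{\mathrm{opt}}$, $J^*\gets J^{\mathrm{opt}}$, $\mathcal{D}\gets\{\alpha^y\}$, otherwise $\mathcal{D}\gets\mathcal{D}\cup\{\alpha^y\}$; (3) let $v^*$ be the minimum-Euclidean-norm element of $\mathrm{conv}(\mathcal{D})+N_{\mathcal{Y}}(y^* )$, where $N_{\mathcal{Y}}(y^* )$ is the normal cone to $\mathcal{Y}$ at $y^*$; (4) set $y\gets y^*-\varepsilon v^*$. Continue while $v^*\neq0$; on termination return $y^*$ and $J^*$. **Robust scheduling algorithm.** Initialize $\mathcal{V}_i\gets\{\text{a vertex of }\Xi_i\}$ for $i=1,2$. Repeat: 1. Run the critical region exploration algorithm with $F_i(y)=\max_{\xi_i\in\mathcal{V}_i}J_i^*(y,\xi_i)$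 to minimize $\max_{\xi_1\in\mathcal{V}_1}J_1^*(y,\xi_1)+\max_{\xi_2\in\mathcal{V}_2}J_2^*(y,\xi_2)$ over $y\in\mathcal{Y}$; let $y^*$ be the optimizer and $J^*$ the optimal cost obtained. 2. For $i=1,2$: maximize $J_i^*(y^*,\cdot)$ over $\Xi_i$, obtaining a maximizer $\xi_i^{\mathrm{opt}}$ that is a vertex of $\Xi_i$ (it is computed by a mixed-integer linear program whose binary variables index vertices of $\Xi_i$), and the maximum $J_i^{\mathrm{opt}}$; set $\mathcal{V}_i\gets\mathcal{V}_i\cup\{\xi_i^{\mathrm{opt}}\}$. Continue while $J_1^{\mathrm{opt}}+J_2^{\mathrm{opt}}>J^*$; terminate otherwise. *)

(* Defs.v *)
From HB Require Import structures.
From mathcomp Require Export all_boot all_order all_algebra.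
From mathcomp Require Export all_classical all_reals.
Set Implicit Arguments.
Unset Strict Implicit.
Unset Printing Implicit Defensive.
Import Order.TTheory GRing.Theory Num.Theory.
Local Open Scope classical_set_scope.
Local Open Scope ring_scope.

Section Convexity.
Variables (R : realType) (n : nat).
Implicit Types (S P Y : set 'cV[R]_n) (x y z u v : 'cV[R]_n).

Definition levec x y : Prop := forall i, x i 0 <= y i 0.

Definition dot u v : R := (u^T *m v) 0 0.

(* The norm that MathComp-Analysis puts on matrices is the sup norm. *)
Definition enorm u : R := Num.sqrt (dot u u).

Definition is_least (A : set R) (m : R) : Prop := A m /\ lbound A m.
Definition is_greatest (A : set R) (m : R) : Prop := A m /\ ubound A m.

(* [0] if the minimum, resp. the maximum, is not attained. *)
Definition set_min (A : set R) : R := xget 0 (is_least A).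
Definition set_max (A : set R) : R := xget 0 (is_greatest A).

Definition affine_hull S : set 'cV[R]_n :=
  [set x | exists k (c : 'I_k -> R) (p : 'I_k -> 'cV[R]_n),
    [/\ forall j, S (p j), \sum_j c j = 1 & x = \sum_j c j *: p j]].

Definition convex_hull S : set 'cV[R]_n :=
  [set x | exists k (c : 'I_k -> R) (p : 'I_k -> 'cV[R]_n),
    [/\ forall j, S (p j), forall j, 0 <= c j, \sum_j c j = 1
      & x = \sum_j c j *: p j]].

(* S contains k + 1 affinely independent points. *)
Definition has_affindep S (k : nat) : Prop :=
  exists (p : 'cV[R]_n) (M : 'M[R]_(n, k)),
    [/\ S p, forall j, S (p + col j M) & \rank M = k].

Definition affine_dim S (k : nat) : Prop :=
  has_affindep S k /\ ~ has_affindep S k.+1.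

Definition relative_interior S : set 'cV[R]_n :=
  [set x | S x /\ exists2 e : R, 0 < e &
    forall z, affine_hull S z -> enorm (z - x) < e -> S z].

Definition polytope P : Prop :=
  (exists k (A : 'M[R]_(k, n)) (b : 'cV[R]_k),
     P = [set z | forall i, (A *m z) i 0 <= b i 0]) /\
  (exists M : R, forall z, P z -> enorm z <= M).

Definition vertex S : set 'cV[R]_n :=
  [set x | S x /\ forall u v (t : R), S u -> S v -> 0 < t < 1 ->
    x = t *: u + (1 - t) *: v -> u = x /\ v = x].

Definition normal_cone Y y : set 'cV[R]_n :=
  [set v | forall z, Y z -> dot v (z - y) <= 0].

Definition lexle x y : Prop :=
  x = y \/ exists k : 'I_n,
    (forall j : 'I_n, (j < k)%N -> x j 0 = y j 0) /\ x k 0 < y k 0.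

Definition min_norm S v : Prop := S v /\ forall u, S u -> enorm v <= enorm u.

(* z is the lexicographically smallest minimizer of [alpha]^T z + beta on P,
   and J is the minimum. *)
Definition lex_argmin P (alpha : 'cV[R]_n) (beta : R) z (J : R) : Prop :=
  [/\ P z, J = dot alpha z + beta,
      forall z', P z' -> J <= dot alpha z' + beta
    & forall z', P z' -> dot alpha z' + beta = J -> lexle z z'].

End Convexity.

(* One area, with n internal buses, m boundary buses, l line limits, and m'
   boundary buses in the neighbouring area.  The suffixes [i], [b], [b'] refer
   to internal, own boundary and neighbouring boundary buses. *)
Record area (R : realType) (n m m' l : nat) := Area {
  B_ii : 'M[R]_n;
  B_ib : 'M[R]_(n, m);
  B_bi : 'M[R]_(m, n);
  B_bb : 'M[R]_m;
  B_bb' : 'M[R]_(m, m');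
  Gmin : 'cV[R]_n;
  Gmax : 'cV[R]_n;
  H_i : 'M[R]_(l, n);
  H_b : 'M[R]_(l, m);
  f_lim : 'cV[R]_l;
  P_g : 'cV[R]_n;
  P_w : 'cV[R]_n;
  P_d : 'cV[R]_n;
  xiL : 'cV[R]_(n + (n + n));
  xiU : 'cV[R]_(n + (n + n)) }.

Record dispatch (R : realType) (n : nat) := Dispatch {
  gen : 'cV[R]_n;
  wind : 'cV[R]_n;
  load : 'cV[R]_n;
  theta : 'cV[R]_n }.

Section Area.
Variables (R : realType) (n m m' l : nat) (A : area R n m m' l).
Implicit Types (xi : 'cV[R]_(n + (n + n))) (x : dispatch R n).
Implicit Types (own : 'cV[R]_m) (other : 'cV[R]_m').

(* xi stacks the renewable capacity and the lower and upper load limits. *)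
Definition Wmax xi : 'cV[R]_n := usubmx xi.
Definition Dmin xi : 'cV[R]_n := usubmx (dsubmx xi).
Definition Dmax xi : 'cV[R]_n := dsubmx (dsubmx xi).

Definition uncertainty_set : set 'cV[R]_(n + (n + n)) :=
  [set xi | levec (xiL A) xi /\ levec xi (xiU A)].

Definition power_flow own other x : Prop :=
  B_ii A *m theta x + B_ib A *m own = gen x + wind x - load x /\
  B_bi A *m theta x + B_bb A *m own + B_bb' A *m other = 0.

Definition asset_limits xi x : Prop :=
  [/\ levec (Gmin A) (gen x) /\ levec (gen x) (Gmax A),
      levec 0 (wind x) /\ levec (wind x) (Wmax xi)
    & levec (Dmin xi) (load x) /\ levec (load x) (Dmax xi)].

Definition line_limits own x : Prop :=
  levec (H_i A *m theta x + H_b A *m own) (f_lim A).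

Definition feasible own other xi x : Prop :=
  [/\ power_flow own other x, asset_limits xi x & line_limits own x].

Definition cost xi x : R :=
  dot (P_g A) (gen x) + dot (P_w A) (Wmax xi - wind x)
  + dot (P_d A) (Dmax xi - load x).

Definition Jarea own other xi : R :=
  set_min [set cost xi x | x in feasible own other xi].

End Area.

(* Tie-line limits, slack bus (a boundary bus of area 1) and bounds on the
   boundary phase angles. *)
Record tie (R : realType) (m1 m2 l : nat) := Tie {
  H12 : 'M[R]_(l, m1);
  H21 : 'M[R]_(l, m2);
  f12 : 'cV[R]_l;
  slack : 'I_m1;
  ymin : 'cV[R]_(m1 + m2);
  ymax : 'cV[R]_(m1 + m2) }.

Definition tie_set (R : realType) (m1 m2 l : nat) (T : tie R m1 m2 l) :
    set 'cV[R]_(m1 + m2) :=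
  [set y | [/\ levec (H12 T *m usubmx y + H21 T *m dsubmx y) (f12 T),
               usubmx y (slack T) 0 = 0,
               levec (ymin T) y & levec y (ymax T)]].

Definition J1 (R : realType) (n1 m1 m2 l1 : nat) (A1 : area R n1 m1 m2 l1)
    (y : 'cV[R]_(m1 + m2)) xi := Jarea A1 (usubmx y) (dsubmx y) xi.

Definition J2 (R : realType) (n2 m1 m2 l2 : nat) (A2 : area R n2 m2 m1 l2)
    (y : 'cV[R]_(m1 + m2)) xi := Jarea A2 (dsubmx y) (usubmx y) xi.

Definition worst_case (R : realType) (N q : nat)
    (J : 'cV[R]_N -> 'cV[R]_q -> R) (V : set 'cV[R]_q) (y : 'cV[R]_N) : R :=
  set_max [set J y xi | xi in V].

Definition is_minimizer (T : Type) (R : realType) (Y : set T) (F : T -> R)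
    (y : T) : Prop := Y y /\ forall z, Y z -> F y <= F z.

Record regions (R : realType) (N : nat) := Regions {
  nreg : nat;
  reg : 'I_nreg -> set 'cV[R]_N;
  slope : 'I_nreg -> 'cV[R]_N;
  offset : 'I_nreg -> R }.
Arguments reg {R N} C j : rename.
Arguments slope {R N} C j : rename.
Arguments offset {R N} C j : rename.

(* Since Y need not be full-dimensional, "intersecting only at their
   boundaries" refers to relative boundaries. *)
Definition critical_regions (R : realType) (N : nat) (Y : set 'cV[R]_N)
    (F : 'cV[R]_N -> R) (C : regions R N) : Prop :=
  [/\ forall j, polytope (reg C j) /\
        exists k, affine_dim (reg C j) k /\ affine_dim Y k,
      forall j k z, j != k -> reg C j z -> reg C k z ->
        ~ relative_interior (reg C j) z /\ ~ relative_interior (reg C k) z,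
      Y = [set z | exists j, reg C j z]
    & forall j z, reg C j z -> F z = dot (slope C j) z + offset C j].

(* [cre_best] is meaningless as long as [cre_val] is +oo. *)
Record cre_state (R : realType) (N : nat) := CreState {
  cre_point : 'cV[R]_N;
  cre_best : 'cV[R]_N;
  cre_val : \bar R;
  cre_slopes : set 'cV[R]_N }.

(* Steps (1)-(3) of one iteration of critical region exploration, from s; the
   iteration leaves y* , J* , D equal to ybest, val, D and computes v. *)
Definition cre_pass (R : realType) (N : nat) (Y : set 'cV[R]_N)
    (C1 C2 : regions R N) (s : cre_state R N)
    (ybest : 'cV[R]_N) (val : \bar R) (D : set 'cV[R]_N) (v : 'cV[R]_N) : Prop :=
  exists (j1 : 'I_(nreg C1)) (j2 : 'I_(nreg C2)) (yopt : 'cV[R]_N) (Jopt : R),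
    let alpha := slope C1 j1 + slope C2 j2 in
    let beta := offset C1 j1 + offset C2 j2 in
    [/\ reg C1 j1 (cre_point s) /\ reg C2 j2 (cre_point s),
        lex_argmin (reg C1 j1 `&` reg C2 j2) alpha beta yopt Jopt,
        (ybest, val, D) =
          (if (Jopt%:E < cre_val s)%E then (yopt, Jopt%:E, [set alpha])
           else (cre_best s, cre_val s, cre_slopes s `|` [set alpha]))
      & min_norm [set d + p | d in convex_hull D & p in normal_cone Y ybest] v].

Definition cre_init (R : realType) (N : nat) (Y : set 'cV[R]_N)
    (s : cre_state R N) : Prop :=
  [/\ Y (cre_point s), cre_val s = +oo%E & cre_slopes s = set0].

(* Explore V1 V2 s : critical region exploration is in progress, in state s;
   Assess V1 V2 y J : it has returned y and J;
   Done y : the robust scheduling algorithm has terminated, holding y. *)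
Inductive rs_state (R : realType) (N q1 q2 : nat) :=
| Explore of set 'cV[R]_q1 & set 'cV[R]_q2 & cre_state R N
| Assess of set 'cV[R]_q1 & set 'cV[R]_q2 & 'cV[R]_N & \bar R
| Done of 'cV[R]_N.
Arguments Explore {R N q1 q2}.
Arguments Assess {R N q1 q2}.
Arguments Done {R N q1 q2}.

Section RobustScheduling.
Variables (R : realType) (N q1 q2 : nat).
Variables (Y : set 'cV[R]_N) (Xi1 : set 'cV[R]_q1) (Xi2 : set 'cV[R]_q2).
Variables (J1 : 'cV[R]_N -> 'cV[R]_q1 -> R) (J2 : 'cV[R]_N -> 'cV[R]_q2 -> R).
Variables (C1 : set 'cV[R]_q1 -> regions R N).
Variables (C2 : set 'cV[R]_q2 -> regions R N).
Variable (eps : R).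

Definition vertex_maximizer (q : nat) (Xi : set 'cV[R]_q)
    (J : 'cV[R]_N -> 'cV[R]_q -> R) (y : 'cV[R]_N) (xi : 'cV[R]_q) : Prop :=
  vertex Xi xi /\ forall xi', Xi xi' -> J y xi' <= J y xi.

Definition rs_init (s : rs_state R N q1 q2) : Prop :=
  exists xi1 xi2 c, [/\ vertex Xi1 xi1, vertex Xi2 xi2, cre_init Y c
    & s = Explore [set xi1] [set xi2] c].

Inductive rs_step : rs_state R N q1 q2 -> rs_state R N q1 q2 -> Prop :=
| explore_continue V1 V2 s ybest val D v :
    cre_pass Y (C1 V1) (C2 V2) s ybest val D v -> v != 0 ->
    rs_step (Explore V1 V2 s)
      (Explore V1 V2 (CreState (ybest - eps *: v) ybest val D))
| explore_return V1 V2 s ybest val D v :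
    cre_pass Y (C1 V1) (C2 V2) s ybest val D v -> v = 0 ->
    rs_step (Explore V1 V2 s) (Assess V1 V2 ybest val)
| assess_continue V1 V2 y Jstar xi1 xi2 s :
    vertex_maximizer Xi1 J1 y xi1 -> vertex_maximizer Xi2 J2 y xi2 ->
    (Jstar < (J1 y xi1 + J2 y xi2)%:E)%E -> cre_init Y s ->
    rs_step (Assess V1 V2 y Jstar)
      (Explore (V1 `|` [set xi1]) (V2 `|` [set xi2]) s)
| assess_stop V1 V2 y Jstar xi1 xi2 :
    vertex_maximizer Xi1 J1 y xi1 -> vertex_maximizer Xi2 J2 y xi2 ->
    ((J1 y xi1 + J2 y xi2)%:E <= Jstar)%E ->
    rs_step (Assess V1 V2 y Jstar) (Done y).

(* An exploration whose current point has left Y is stuck. *)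
Definition rs_can_step s : Prop := exists s', rs_step s s'.

Definition finite_execution (K : nat) (r : nat -> rs_state R N q1 q2) : Prop :=
  rs_init (r 0%N) /\ forall k, (k < K)%N -> rs_step (r k) (r k.+1).

Definition infinite_execution (r : nat -> rs_state R N q1 q2) : Prop :=
  rs_init (r 0%N) /\ forall k, rs_step (r k) (r k.+1).

(* All nondeterministic choices (initial vertices and points, critical regions
   containing the current point, maximizers) are adversarial: no execution is
   infinite, and one that cannot be extended has ended in a state [Done y]. *)
Definition always_terminates : Prop :=
  (forall r, ~ infinite_execution r) /\
  (forall K r, finite_execution K r ->
     rs_can_step (r K) \/ exists y, r K = Done y).

Definition may_terminate_with (y : 'cV[R]_N) : Prop :=
  exists K r, finite_execution K r /\ r K = Done y.

End RobustScheduling.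

(* Main.v *)
(* Critical region exploration.  While y* is kept, every region visited contains
   y* when eps is small: finitely many pairs y*, v* can occur and a polytope that
   misses y* stays at positive distance.  The step -v* strictly
   decreases every slope in D, whereas a visited slope that brings no improvement
   is minimal at y* over its region and so does not decrease along the step.
   Hence D grows by a new slope or J* drops to another of finitely many values.
   When v* = 0, a convex combination of slopes in D is minus a normal vector of Y
   at y*.  Each of those slopes is a subgradient at y*, because F_i is convex and
   its regions have the dimension of Y, so y* is optimal.

   Robust scheduling.  J_i(y, xi_i) is the value of a linear program, attained and
   jointly convex, so its maximum over the box Xi_i is attained at a vertex.  If
   both maximizers are already in V_1 and V_2 the algorithm stops; otherwise a new
   vertex is added, and there are finitely many.  At termination the optimum over
   V_1 and V_2, a lower bound of the robust optimum, is reached by the robust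
   cost at y*. *)
Require Import Defs.
From mathcomp Require Import all_boot all_order all_algebra.
From mathcomp Require Import all_classical all_reals all_analysis.
From mathcomp Require Import ring lra.
Import numFieldNormedType.Exports.
Import Order.TTheory GRing.Theory Num.Theory.
Set Implicit Arguments.
Unset Strict Implicit.
Unset Printing Implicit Defensive.
Local Open Scope classical_set_scope.
Local Open Scope ring_scope.

(** * Euclidean inner product and norm *)

Section Dot.
Variables (R : realType) (n : nat).
Implicit Types (u v w : 'cV[R]_n).

Lemma dotE u v : dot u v = \sum_i u i 0 * v i 0.
Proof. by rewrite /dot mxE; apply: eq_bigr => i _; rewrite mxE. Qed.

Lemma dotC u v : dot u v = dot v u.
Proof. by rewrite !dotE; apply: eq_bigr => i _; rewrite mulrC. Qed.

Lemma dotDr u v w : dot u (v + w) = dot u v + dot u w.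
Proof. by rewrite /dot mulmxDr mxE. Qed.

Lemma dotZr a u v : dot u (a *: v) = a * dot u v.
Proof. by rewrite /dot -scalemxAr mxE. Qed.

Lemma dotDl u v w : dot (v + w) u = dot v u + dot w u.
Proof. by rewrite dotC dotDr !(dotC u). Qed.

Lemma dotZl a u v : dot (a *: u) v = a * dot u v.
Proof. by rewrite dotC dotZr dotC. Qed.

Lemma dotNr u v : dot u (- v) = - dot u v.
Proof. by rewrite -scaleN1r dotZr mulN1r. Qed.

Lemma dotNl u v : dot (- v) u = - dot v u.
Proof. by rewrite dotC dotNr dotC. Qed.

Lemma dot0r u : dot u 0 = 0.
Proof. by rewrite -(scale0r 0) dotZr mul0r. Qed.

Lemma dot0l u : dot 0 u = 0.
Proof. by rewrite dotC dot0r. Qed.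

Lemma dotBr u v w : dot u (v - w) = dot u v - dot u w.
Proof. by rewrite dotDr dotNr. Qed.

Lemma dotBl u v w : dot (v - w) u = dot v u - dot w u.
Proof. by rewrite dotDl dotNl. Qed.

Lemma dot_suml (I : finType) (F : I -> 'cV[R]_n) u :
  dot (\sum_i F i) u = \sum_i dot (F i) u.
Proof.
by elim/big_rec2: _ => [|i a b _ <-]; rewrite ?dot0l // dotDl.
Qed.

Lemma dot_ge0 u : 0 <= dot u u.
Proof. by rewrite dotE; apply: sumr_ge0 => i _; rewrite -expr2 sqr_ge0. Qed.

Lemma dot_eq0 u : dot u u = 0 -> u = 0.
Proof.
rewrite dotE => /eqP; rewrite psumr_eq0 => [/allP u0|i _]; last first.
  by rewrite -expr2 sqr_ge0.
apply/matrixP => i j; rewrite ord1 mxE.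
by have := u0 i (mem_index_enum i); rewrite mulf_eq0 orbb => /eqP.
Qed.

Lemma dot_gt0 u : u != 0 -> 0 < dot u u.
Proof.
by rewrite lt_def dot_ge0 andbT; apply: contraNneq => /dot_eq0 ->.
Qed.

Lemma le_enorm u v : (enorm u <= enorm v) = (dot u u <= dot v v).
Proof. by rewrite /enorm ler_sqrt // dot_ge0. Qed.

Lemma coord_le_dot u i : u i 0 ^+ 2 <= dot u u.
Proof.
rewrite dotE (bigD1 i) //= expr2 lerDl.
by apply: sumr_ge0 => j _; rewrite -expr2 sqr_ge0.
Qed.

Lemma coord_le_enorm u i : `|u i 0| <= enorm u.
Proof.
by rewrite -(ler_pXn2r (n := 2)) ?nnegrE ?sqrtr_ge0 //
  real_normK ?num_real // sqr_sqrtr ?dot_ge0 // coord_le_dot.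
Qed.

End Dot.

(** * Attainment of the minimum of a bounded linear program *)

Section LinearProgram.
Variables (R : realType) (k n : nat) (A : 'M[R]_(k, n)) (b : 'cV[R]_k).
Implicit Types (z h c : 'cV[R]_n).

Let P z := forall i, (A *m z) i 0 <= b i 0.
Let active z := [set i | (A *m z) i 0 == b i 0]%SET.

Let rowDZ z t h i :
  (A *m (z + t *: h)) i 0 = (A *m z) i 0 + t * (A *m h) i 0.
Proof. by rewrite mulmxDr -scalemxAr [LHS]mxE [X in _ + X]mxE. Qed.

(** Equivalently, [c] is a combination of the rows active at [z]. *)
Let blocked c z : Prop :=
  forall h, (forall i, i \in active z -> (A *m h) i 0 = 0) -> dot c h = 0.

(** Along a descent direction that keeps the active rows tight, boundedness forces another row to
    increase; stopping at the first one reached enlarges the active set. *)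
Let lp_move c L z : (forall z', P z' -> L <= dot c z') -> P z ->
  ~ blocked c z ->
  exists z', [/\ P z', dot c z' <= dot c z & (#|active z| < #|active z'|)%N].
Proof.
move=> lb Pz /existsNP[h0 /not_implyP[act0 ch0]].
have [h [act ch]] : exists h,
    (forall i, i \in active z -> (A *m h) i 0 = 0) /\ dot c h < 0.
  have [lt0|gt0|/ch0 //] := ltrgt0P (dot c h0).
    exists (- h0); split; last by rewrite dotNr oppr_lt0.
    by move=> i /act0 Ah0; rewrite mulmxN [LHS]mxE Ah0 oppr0.
  by exists h0.
have [i0 hi0] : exists i, 0 < (A *m h) i 0.
  apply: contrapT => /forallNP noi.
  (* If no row increases, the whole ray is feasible, and this [t] brings the objective down to
     [L - 1]. *)
  pose t := (dot c z - L + 1) / (- dot c h).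
  have t0 : 0 <= t.
    by apply: divr_ge0; [have := lb _ Pz; lra | lra].
  have /lb : P (z + t *: h).
    move=> i; rewrite rowDZ -[leRHS]addr0 lerD //.
    by rewrite mulr_ge0_le0 // leNgt; apply/negP.
  rewrite dotDr dotZr /t invrN mulrN mulNr mulfVK ?lt_eqF //; lra.
(* Ratio test: for a row that increases along [h], [q i] is the step length at which row [i] becomes
   tight. *)
pose q i := (b i 0 - (A *m z) i 0) / (A *m h) i 0.
have [i hi qmin] := @Order.TotalTheory.arg_minP _ _ _ i0
  (fun i => 0 < (A *m h) i 0) q hi0.
have q0 : 0 <= q i by rewrite divr_ge0 ?subr_ge0 // ltW.
exists (z + q i *: h); split.
- move=> j; rewrite rowDZ; have [hj|hj] := ltrP 0 ((A *m h) j 0).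
    have := qmin j hj; rewrite /q [X in _ <= X]mulrC.
    by rewrite ler_pdivlMl // => ?; lra.
  by rewrite -[leRHS]addr0 lerD // mulr_ge0_le0.
- by rewrite dotDr dotZr gerDl mulr_ge0_le0 // ltW.
- apply/proper_card/properP; split.
    apply/fintype.subsetP => j jz; have := jz; rewrite !inE rowDZ act // mulr0 addr0.
    by [].
  exists i; first by rewrite inE rowDZ /q mulfVK ?(gt_eqF hi) // subrKC.
  by apply/negP => /act hi0'; rewrite hi0' ltxx in hi.
Qed.

(** There are only [k] rows, so finitely many moves suffice; the induction is on the number of
    inactive rows. *)
Let lp_descend c L z : (forall z', P z' -> L <= dot c z') -> P z ->
  exists z', [/\ P z', dot c z' <= dot c z & blocked c z'].
Proof.
move=> lb; have [d] := ubnP (k - #|active z|)%N.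
elim: d z => // d IHd z dz Pz.
have [bz|nbz] := pselect (blocked c z); first by exists z.
have [z1 [Pz1 cz1 act1]] := lp_move lb Pz nbz.
have kz1 : (#|active z1| <= k)%N by rewrite -[leqRHS]card_ord max_card.
have [|z2 [Pz2 cz2 bz2]] := IHd z1 _ Pz1.
  move: dz; rewrite ltnS; apply: leq_trans.
  by apply: ltn_sub2l => //; apply: leq_trans kz1.
by exists z2; split=> //; apply: le_trans cz1.
Qed.

(* The value of a blocked point depends only on its set of active constraints,
   so only finitely many values compete for the minimum. *)
Lemma lp_attained c L : (exists z, P z) ->
    (forall z, P z -> L <= dot c z) ->
  exists z, P z /\ forall z', P z' -> dot c z <= dot c z'.
Proof.
move=> [z0 Pz0] lb.
have [z1 [Pz1 _ bz1]] := lp_descend lb Pz0.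
(* [f I] is a blocked point with active set exactly [I] when there is one, and the default [z1]
   otherwise. *)
have /choice[f fP] : forall I : {set 'I_k}, exists z, [/\ P z, blocked c z &
    forall z', P z' -> blocked c z' -> active z' = I -> active z = I].
  move=> I.
  have [[z [Pz bz zI]]|no] :=
      pselect (exists z, [/\ P z, blocked c z & active z = I]).
    by exists z.
  by exists z1; split=> // z' Pz' bz' z'I; case: no; exists z'.
have [I _ Imin] := @Order.TotalTheory.arg_minP _ _ _
  (finset.set0 : {set 'I_k}) xpredT (fun I => dot c (f I)) isT.
exists (f I); split; first by have [] := fP I.
move=> z' /(lp_descend lb)[z [Pz cz bz]]; apply: le_trans cz.
apply: le_trans (Imin (active z) isT) _.
have [Pf bf /(_ _ Pz bz erefl) fz] := fP (active z).
(* Both points have the same active rows, so their difference is a direction that [blocked]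
   controls. *)
suff : dot c (z - f (active z)) = 0 by rewrite dotBr => ?; lra.
apply: bz => i iz; have : i \in active (f (active z)) by rewrite fz.
rewrite inE => /eqP fi.
have := iz; rewrite inE => /eqP zi.
by rewrite mulmxBr [LHS]mxE [X in _ + X]mxE zi fi subrr.
Qed.

End LinearProgram.

(** * Polyhedra and lexicographic linear minimization *)

Section Polyhedra.
Variables (R : realType) (n : nat).
Implicit Types (P Q : set 'cV[R]_n) (c u v z : 'cV[R]_n).

Definition polyhedron P : Prop :=
  exists k (A : 'M[R]_(k, n)) (b : 'cV[R]_k),
    P = [set z | forall i, (A *m z) i 0 <= b i 0].

Definition is_convex P : Prop :=
  forall u v (t : R), P u -> P v -> 0 <= t -> t <= 1 ->
    P (t *: u + (1 - t) *: v).

Lemma polyhedronE P : polyhedron P ->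
  exists k (a : 'I_k -> 'cV[R]_n) (b : 'I_k -> R),
    forall z, P z <-> forall i, dot (a i) z <= b i.
Proof.
move=> [k [A [b ->]]]; exists k, (fun i => (row i A)^T), (fun i => b i 0) => z.
have E i : dot (row i A)^T z = (A *m z) i 0.
  by rewrite dotE mxE; apply: eq_bigr => j _; rewrite !mxE.
by split=> Az i; have := Az i; rewrite E.
Qed.

Lemma polyhedron_le (k : nat) (A : 'M[R]_(k, n)) (b : 'cV[R]_k) :
  polyhedron [set z | levec (A *m z) b].
Proof. by exists k, A, b. Qed.

Lemma polyhedron_dot_le c r : polyhedron [set z | dot c z <= r].
Proof.
exists 1%N, c^T, (const_mx r); apply/seteqP; split=> z /=.
  by move=> cz i; rewrite ord1 [leRHS]mxE.
by move=> /(_ 0); rewrite [leRHS]mxE.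
Qed.

Lemma polyhedronI P Q : polyhedron P -> polyhedron Q -> polyhedron (P `&` Q).
Proof.
move=> [k [A [b ->]]] [l [B [d ->]]].
exists (k + l)%N, (col_mx A B), (col_mx b d); apply/seteqP; split=> z /=.
  move=> [Az Bz] i; rewrite mul_col_mx.
  by case: (split_ordP i) => j ->; rewrite ?col_mxEu ?col_mxEd.
move=> AB; split=> i.
  by have := AB (lshift l i); rewrite mul_col_mx !col_mxEu.
by have := AB (rshift k i); rewrite mul_col_mx !col_mxEd.
Qed.

Lemma polyhedron_convex P : polyhedron P -> is_convex P.
Proof.
move=> /polyhedronE[k [a [b Pab]]] u v t /Pab Pu /Pab Pv t0 t1.
apply/Pab => i; rewrite dotDr !dotZr.
by have := Pu i; have := Pv i; nra.
Qed.

Lemma polytope_polyhedron P : polytope P -> polyhedron P.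
Proof. by case. Qed.

Lemma polytopeI P Q : polytope P -> polyhedron Q -> polytope (P `&` Q).
Proof.
by move=> [pP [M PM]] pQ; split; [exact: polyhedronI | exists M => z []/PM].
Qed.

Lemma polyhedron_min P c L : polyhedron P -> P !=set0 ->
    (forall z, P z -> L <= dot c z) ->
  exists z, P z /\ forall z', P z' -> dot c z <= dot c z'.
Proof. by move=> [k [A [b ->]]] P0 lb; apply: lp_attained P0 lb. Qed.

Lemma polytope_min P c : polytope P -> P !=set0 ->
  exists z, P z /\ forall z', P z' -> dot c z <= dot c z'.
Proof.
move=> [pP [M PM]] P0.
(* A bound on the norm bounds every coordinate, and hence the objective from below. *)
apply: (@polyhedron_min P c (- \sum_i `|c i 0| * M)) => // z Pz.
rewrite dotE -sumrN; apply: ler_sum => i _.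
rewrite lerNl (le_trans (ler_norm _)) // normrN normrM ler_wpM2l //.
by rewrite (le_trans (coord_le_enorm _ _)) ?PM.
Qed.

Lemma lexle_anti u v : lexle u v -> lexle v u -> u = v.
Proof.
move=> [//|[i [ui lti]]] [//|[j [uj ltj]]].
have [ij|ji|eij] := ltngtP i j.
- by move: lti; rewrite uj // ltxx.
- by move: ltj; rewrite ui // ltxx.
- by move: ltj; rewrite -(val_inj eij) => /(lt_trans lti); rewrite ltxx.
Qed.

(** The coordinates are minimized one after another over the face of minimizers; each stage leaves a
    nonempty polytope. *)
Lemma lex_argmin_exists P c (beta : R) : polytope P -> P !=set0 ->
  exists z J, lex_argmin P c beta z J.
Proof.
move=> pP P0; have [z0 [Pz0 z0min]] := polytope_min c pP P0.
pose Q0 := P `&` [set z | dot c z <= dot c z0].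
(* At stage [k] the points of [Q] agree in their first [k] coordinates, and any minimizer outside
   [Q] is lexicographically larger. *)
have lex k : (k <= n)%N -> exists Q, [/\ polytope Q, Q !=set0, Q `<=` Q0 &
    forall z z', Q z -> Q0 z' ->
      (Q z' /\ forall j : 'I_n, (j < k)%N -> z j 0 = z' j 0) \/
      exists j : 'I_n, (forall i : 'I_n, (i < j)%N -> z i 0 = z' i 0) /\
                       z j 0 < z' j 0].
  elim: k => [_|k IHk kn].
    exists Q0; split=> //; first exact/polytopeI/polyhedron_dot_le.
      by exists z0; split=> /=.
    by move=> z z' _ Qz'; left; split.
  have [Q [pQ Qn0 QQ0 Qlex]] := IHk (ltnW kn).
  pose e : 'cV[R]_n := delta_mx (Ordinal kn) 0.
  have eE z : dot e z = z (Ordinal kn) 0.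
    rewrite dotE (bigD1 (Ordinal kn)) //= big1 => [|i ni].
      by rewrite addr0 mxE !eqxx mul1r.
    by rewrite mxE (negbTE ni) mul0r.
  have [z1 [Qz1 z1min]] := polytope_min e pQ Qn0.
  exists (Q `&` [set z | dot e z <= dot e z1]); split.
  - exact/polytopeI/polyhedron_dot_le.
  - by exists z1; split=> /=.
  - by move=> z [/QQ0].
  move=> z z' [Qz /= ez] Qz'; have [[Q'z' zz']|] := Qlex z z' Qz Qz'; last by right.
  have := z1min z' Q'z'; rewrite le_eqVlt => /orP[/eqP ez'|ez'].
    left; split; first by split=> //=; rewrite ez'.
    move=> j; rewrite ltnS leq_eqVlt => /orP[/eqP jk|/zz' //].
    have -> : j = Ordinal kn by apply: val_inj.
    by rewrite -!eE -ez'; apply/le_anti; rewrite ez z1min.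
  right; exists (Ordinal kn); split; first by move=> i /zz'.
  by rewrite -!eE (le_lt_trans ez).
have [Q [_ [z Qz] QQ0 Qlex]] := lex n (leqnn n).
have [Pz cz] := QQ0 z Qz.
have cz0 : dot c z = dot c z0 by apply/le_anti; rewrite cz z0min.
exists z, (dot c z + beta); split=> // [z' Pz'|z' Pz' cz'].
  by rewrite cz0 lerD2r z0min.
have [|[_ zz']|[j zz']] := Qlex z z' Qz; last by right; exists j.
  by split=> //=; rewrite -cz0; move/addIr: cz' => ->.
by left; apply/matrixP => i j; rewrite ord1 zz'.
Qed.

Lemma lex_argmin_unique P c (beta : R) u v (J J' : R) :
  lex_argmin P c beta u J -> lex_argmin P c beta v J' -> u = v /\ J = J'.
Proof.
move=> [Pu Ju umin ulex] [Pv Jv vmin vlex].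
have JJ' : J = J'.
  by apply/le_anti/andP; split; [rewrite Jv; exact: umin|rewrite Ju; exact: vmin].
by split=> //; apply: lexle_anti;
  [apply: ulex; rewrite // JJ' | apply: vlex; rewrite // -JJ'].
Qed.

End Polyhedra.

(** * Minima of continuous functions on closed bounded sets *)

Section ClosedMinimum.
Variables (R : realType) (n : nat).

Lemma continuous_linear_form (l : 'I_n -> R) :
  continuous (fun w : 'rV[R]_n => \sum_i w 0 i * l i).
Proof.
apply: (continuous_big (op := +%R)) => [|i _]; first exact: add_continuous.
move=> w; apply: continuousM; [exact: coord_continuous | exact: cst_continuous].
Qed.

Lemma closed_le_continuous (f : 'rV[R]_n -> R) (r : R) :
  continuous f -> closed [set w | f w <= r].
Proof.
by move=> /continuous_closedP /(_ [set x | x <= r]); apply; exact: closed_le.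
Qed.

Lemma closed_bounded_min (K : set 'rV[R]_n) (f : 'rV[R]_n -> R) (M : R) :
    closed K -> K !=set0 -> (forall w i, K w -> `|w 0 i| <= M) ->
    continuous f ->
  exists w, K w /\ forall w', K w' -> f w <= f w'.
Proof.
move=> clK K0 KM cf.
have cK : compact K.
  have cB := rV_compact (fun _ : 'I_n => @segment_compact R (- M) M).
  apply: subclosed_compact clK cB _.
  by move=> w Kw i /=; rewrite in_itv /= -ler_norml KM.
have [w Kw wmin] := EVT_min_rV K0 cK (continuous_subspaceT cf).
by exists w; split; [rewrite inE in Kw | move=> w' Kw'; apply: wmin; rewrite inE].
Qed.

End ClosedMinimum.

(** * Minimum-norm elements of a convex hull plus a normal cone *)

Section MinimumNorm.
Variables (R : realType) (n : nat).
Implicit Types (S Y D : set 'cV[R]_n) (u v y z : 'cV[R]_n).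

Lemma sub_convex_hull S : S `<=` convex_hull S.
Proof.
move=> x Sx; exists 1%N, (fun=> 1), (fun=> x).
by split=> //; rewrite big_ord1 // scale1r.
Qed.

(** Weights of points with the same index are added, so one coefficient per index suffices; this
    fixes the dimension for the compactness argument. *)
Lemma convex_hull_range k (a : 'I_k -> 'cV[R]_n) x :
  convex_hull (range a) x ->
  exists c : 'I_k -> R,
    [/\ forall i, 0 <= c i, \sum_i c i = 1 & x = \sum_i c i *: a i].
Proof.
move=> [l [c [p [/(_ _)/cid2-/all_sig2[f _ fp] c0 c1 ->]]]].
exists (fun i => \sum_(j | f j == i) c j); split.
- by move=> i; apply: sumr_ge0.
- by rewrite -c1 [RHS](partition_big f xpredT).
- rewrite (partition_big f xpredT) //; apply: eq_bigr => i _.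
  by rewrite scaler_suml; apply: eq_bigr => j /eqP <-; rewrite fp.
Qed.

Lemma convex_hull_convex S : is_convex (convex_hull S).
Proof.
move=> _ _ t [k [c [p [Sp c0 c1 ->]]]] [l [d [q [Sq d0 d1 ->]]]] t0 t1.
exists (k + l)%N,
  (fun i => match fintype.split i with
            | inl j => t * c j | inr j => (1 - t) * d j end),
  (fun i => match fintype.split i with inl j => p j | inr j => q j end).
have sl j : fintype.split (lshift l j : 'I_(k + l)) = inl j := unsplitK (inl j).
have sr j : fintype.split (rshift k j : 'I_(k + l)) = inr j := unsplitK (inr j).
split.
- by move=> i; case: fintype.split.
- by move=> i; case: fintype.split => j; rewrite mulr_ge0 // subr_ge0.
- rewrite big_split_ord /=.
  under eq_bigr do rewrite sl; under [X in _ + X]eq_bigr do rewrite sr.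
  by rewrite -!mulr_sumr c1 d1; ring.
- rewrite big_split_ord /= !scaler_sumr; congr (_ + _); apply: eq_bigr => j _.
    by rewrite sl scalerA.
  by rewrite sr scalerA.
Qed.

Lemma normal_cone0 Y y : normal_cone Y y 0.
Proof. by move=> z _; rewrite dot0l. Qed.

Lemma normal_coneD Y y u v :
  normal_cone Y y u -> normal_cone Y y v -> normal_cone Y y (u + v).
Proof.
by move=> Nu Nv z Yz; rewrite dotDl; have := Nu z Yz; have := Nv z Yz; lra.
Qed.

Lemma normal_coneZ Y y u (t : R) :
  0 <= t -> normal_cone Y y u -> normal_cone Y y (t *: u).
Proof. by move=> t0 Nu z Yz; rewrite dotZl mulr_ge0_le0 // Nu. Qed.

(** The set whose minimum-norm element is the search direction in [cre_pass]. *)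
Definition hull_cone D Y y : set 'cV[R]_n :=
  [set d + p | d in convex_hull D & p in normal_cone Y y].

Lemma hull_coneD D Y y u v :
  hull_cone D Y y u -> normal_cone Y y v -> hull_cone D Y y (u + v).
Proof.
move=> [d Dd [p Np <-]] Nv.
by exists d => //; exists (p + v); [exact: normal_coneD | rewrite addrA].
Qed.

Lemma sub_hull_cone D Y y : D `<=` hull_cone D Y y.
Proof.
move=> d Dd; exists d; first exact: sub_convex_hull.
by exists 0; [exact: normal_cone0 | rewrite addr0].
Qed.

Lemma hull_cone_convex D Y y : is_convex (hull_cone D Y y).
Proof.
move=> _ _ t [d Dd [p Np <-]] [e De [q Nq <-]] t0 t1.
exists (t *: d + (1 - t) *: e); first exact: convex_hull_convex.
exists (t *: p + (1 - t) *: q).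
  by apply: normal_coneD; apply: normal_coneZ => //; rewrite subr_ge0.
by rewrite !scalerDr addrACA.
Qed.

(** Otherwise a short move from [v] towards [u] would stay in [S] and have smaller norm. *)
Lemma min_norm_variational S u v :
  is_convex S -> min_norm S v -> S u -> dot v v <= dot v u.
Proof.
move=> cS [Sv vmin] Su; rewrite leNgt; apply/negP => lt.
pose a := dot (u - v) (u - v); pose b := dot v v - dot v u.
have b0 : 0 < b by rewrite subr_gt0.
have a0 : 0 < a.
  rewrite dot_gt0 // subr_eq0; apply: contraTN lt => /eqP ->.
  by rewrite ltxx.
(* The squared norm changes by [t ^+ 2 * a - 2 * t * b], which is at most [- t * b] since
   [t * a <= b]. *)
pose t := Num.min 1 (b / a).
have t0 : 0 < t by rewrite lt_min ltr01 divr_gt0.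
have t1 : t <= 1 by rewrite ge_min lexx.
have ta : t * a <= b by rewrite -ler_pdivlMr // ge_min lexx orbT.
have := vmin _ (cS u v t Su Sv (ltW t0) t1); rewrite le_enorm.
have -> : t *: u + (1 - t) *: v = v + t *: (u - v).
  by rewrite scalerBl scale1r scalerBr addrCA.
have vw : dot v (u - v) = - b by rewrite dotBr opprB.
have aE : dot (u - v) (u - v) = a by [].
move: (u - v) aE vw => w aE vw.
by rewrite !(dotDl, dotDr, dotZl, dotZr) (dotC w v) vw aE; nra.
Qed.

(** The two variational inequalities add up to [dot (u - v) (u - v) <= 0]. *)
Lemma min_norm_unique S u v :
  is_convex S -> min_norm S u -> min_norm S v -> u = v.
Proof.
move=> cS mu mv; have [Su _] := mu; have [Sv _] := mv.
have uv := min_norm_variational cS mu Sv.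
have vu := min_norm_variational cS mv Su.
apply/eqP; rewrite -subr_eq0; apply/eqP/dot_eq0/le_anti.
by rewrite dot_ge0 andbT !(dotBl, dotBr); move: vu; rewrite (dotC v u); lra.
Qed.

(** Hull weights and normal vector are collected in one row vector [w], on which the element of the
    set depends linearly. The squared norm is then minimized over a closed bounded sublevel set. *)
Lemma min_norm_exists D Y y : finite_set D -> D !=set0 ->
  exists v, min_norm (hull_cone D Y y) v.
Proof.
move=> /finite_seqP[s sD] [d0 Dd0].
pose k := size s; pose a (i : 'I_k) := s`_i.
have aD : range a = D.
  rewrite sD; apply/seteqP; split=> [_ [i _ <-]|x /= xs]; first exact: mem_nth.
  have := xs; rewrite -index_mem => xk.
  by exists (Ordinal xk); rewrite // /a nth_index.
pose A : 'M[R]_(k + n, n) := col_mx (\matrix_(i, j) a i j 0) 1%:M.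
pose c (w : 'rV[R]_(k + n)) i : R := w 0 (lshift n i).
pose p (w : 'rV[R]_(k + n)) : 'cV[R]_n := \col_j w 0 (rshift k j).
pose phi (w : 'rV[R]_(k + n)) := (w *m A)^T.
have phiE w : phi w = \sum_i c w i *: a i + p w.
  apply/matrixP => j j'; rewrite ord1 !mxE big_split_ord /= summxE; congr (_ + _).
    by apply: eq_bigr => i _; rewrite col_mxEu !mxE.
  rewrite (bigD1 j) //= big1 => [|i ij]; rewrite col_mxEd mxE ?eqxx ?mulr1 ?addr0 //.
  by rewrite (negbTE ij) mulr0.
pose f w := dot (phi w) (phi w).
have c_cont i : continuous (c^~ i) by exact: coord_continuous.
have lin_cont := @continuous_linear_form R (k + n).
have f_cont : continuous f.
  have fE : f = fun w => \sum_j (\sum_i w 0 i * A i j) * (\sum_i w 0 i * A i j).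
    by apply/funext => w; rewrite /f dotE; apply: eq_bigr => j _; rewrite !mxE.
  rewrite fE.
  apply: (continuous_big (op := +%R)) => [|j _]; first exact: add_continuous.
  by move=> w; apply: continuousM; exact: lin_cont.
(* All weight on [d0] and a zero normal vector: this point supplies the level that bounds [K]. *)
have [w0 w0c w0p] : exists2 w, [/\ forall i, 0 <= c w i, \sum_i c w i = 1 &
    phi w = d0] & p w = 0.
  have : range a d0 by rewrite aD.
  move=> [i _ <-]; exists (delta_mx 0 (lshift n i)).
    have cE j : c (delta_mx 0 (lshift n i)) j = (j == i)%:R.
      by rewrite /c mxE eqxx (inj_eq (@lshift_inj _ _)).
    have pE : p (delta_mx 0 (lshift n i)) = 0.
      by apply/matrixP => j j'; rewrite !mxE eq_rlshift andbF.
    split=> [j||]; first by rewrite cE ler0n.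
      rewrite (bigD1 i) //= big1 => [|j /negbTE ji]; first by rewrite cE eqxx addr0.
      by rewrite cE ji.
    rewrite phiE pE addr0 (bigD1 i) //= big1 => [|j /negbTE ji].
      by rewrite cE eqxx addr0 scale1r.
    by rewrite cE ji scale0r.
  by apply/matrixP => j j'; rewrite !mxE eq_rlshift andbF.
pose K := [set w | [/\ forall i, 0 <= c w i, \sum_i c w i = 1,
  normal_cone Y y (p w) & f w <= f w0]].
have Kw0 : K w0.
  by case: w0c => ? ? _; split=> //; rewrite w0p; exact: normal_cone0.
have clK : closed K.
  have -> : K = (\bigcap_i [set w | - c w i <= 0]) `&`
      ([set w | \sum_i c w i <= 1] `&` [set w | - \sum_i c w i <= -1]) `&`
      (\bigcap_(z in Y) [set w | dot (p w) (z - y) <= 0]) `&`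
      [set w | f w <= f w0].
    apply/seteqP; split=> w.
      move=> [cw0 cw1 Nw fw]; split=> //; split=> //; split=> //=.
        by move=> i _ /=; rewrite oppr_le0.
      by rewrite cw1.
    move=> [[[cw0 [/= cw1 cw1']] Nw] fw]; split=> //.
      by move=> i; have := cw0 i I; rewrite /= oppr_le0.
    by apply/le_anti; rewrite cw1 -lerN2.
  have sum_cont : continuous (fun w => \sum_i c w i).
    by apply: (continuous_big (op := +%R)) => [|i _] //; exact: add_continuous.
  apply: closedI; last exact: closed_le_continuous.
  apply: closedI; first apply: closedI; last 1 first.
  - apply: closed_bigI => z _; apply: closed_le_continuous.
    have -> : (fun w => dot (p w) (z - y)) =
        (fun w => \sum_j w 0 (rshift k j) * (z - y) j 0).
      by apply/funext => w; rewrite dotE; apply: eq_bigr => j _; rewrite mxE.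
    apply: (continuous_big (op := +%R)) => [|j _]; first exact: add_continuous.
    move=> w; apply: continuousM; last exact: cst_continuous.
    exact: coord_continuous.
  - apply: closed_bigI => i _; apply: closed_le_continuous => w.
    exact/continuousN/c_cont.
  - apply: closedI; apply: closed_le_continuous => // w.
    exact/continuousN/sum_cont.
(* Weights lie in the unit interval; a normal vector is [phi w], of norm at most [Num.sqrt (f w0)],
   minus a convex combination of the [a i]. *)
pose B := 1 + Num.sqrt (f w0) + \sum_i \sum_j `|a i j 0|.
have KB w i : K w -> `|w 0 i| <= B.
  move=> [cw0 cw1 _ fw].
  have S0 : 0 <= \sum_i \sum_j `|a i j 0|.
    by apply: sumr_ge0 => i' _; apply: sumr_ge0.
  have cle i' : c w i' <= 1.
    by rewrite -cw1 (bigD1 i') //= lerDl sumr_ge0.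
  have f0 := sqrtr_ge0 (f w0).
  case: (split_ordP i) => j ->.
    by rewrite -/(c w j) ger0_norm ?cw0 // /B; have := cle j; lra.
  have -> : w 0 (rshift k j) = phi w j 0 - \sum_i c w i * a i j 0.
    rewrite phiE [X in _ = X - _]mxE summxE.
    under eq_bigr do rewrite mxE.
    by rewrite mxE; ring.
  rewrite (le_trans (ler_normB _ _)) // lerD //.
    rewrite (le_trans (coord_le_enorm _ _)) //.
    rewrite (@le_trans _ _ (Num.sqrt (f w0))) //; last by lra.
    by rewrite ler_sqrt // dot_ge0.
  rewrite (le_trans (ler_norm_sum _ _ _)) // ler_sum // => i' _.
  rewrite normrM ger0_norm ?cw0 // (bigD1 j) //=.
  rewrite -[leLHS]addr0 lerD ?sumr_ge0 //.
  by rewrite -[leRHS]mul1r ler_wpM2r.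
have [w [Kw wmin]] := closed_bounded_min clK (ex_intro _ _ Kw0) KB f_cont.
exists (phi w); split.
  case: Kw => cw0 cw1 Nw _; exists (\sum_i c w i *: a i).
    exists k, (c w), a; split=> // i; rewrite -aD; by exists i.
  by exists (p w); rewrite // phiE.
move=> _ [d + [q Nq <-]]; rewrite -aD => /convex_hull_range[e [e0 e1 ->]].
pose w1 : 'rV[R]_(k + n) := row_mx (\row_i e i) q^T.
have cw1 : c w1 = e by apply/funext => i; rewrite /c row_mxEl mxE.
have pw1 : p w1 = q by apply/matrixP => i j; rewrite ord1 mxE row_mxEr mxE.
have phi1 : phi w1 = \sum_i e i *: a i + q by rewrite phiE cw1 pw1.
rewrite -phi1 le_enorm.
(* A point above the level of [w0] lies outside [K], but [w0] already beats it. *)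
have [fw1|fw1] := lerP (f w1) (f w0).
  by apply: wmin; split; rewrite ?cw1 ?pw1.
by rewrite (le_trans (wmin _ Kw0)) // ltW.
Qed.

End MinimumNorm.

(** * Properties that hold for all small step sizes *)

Section ForSmall.
Variable R : realType.

(** Stability under finite conjunctions lets one threshold serve all scenario sets and regions. *)
Definition for_small (P : R -> Prop) : Prop :=
  exists2 e0, 0 < e0 & forall e, 0 < e -> e <= e0 -> P e.

Lemma for_small_imp (P Q : R -> Prop) :
  (forall e, 0 < e -> P e -> Q e) -> for_small P -> for_small Q.
Proof. by move=> PQ [e0 e00 Pe]; exists e0 => // e e1 e2; apply/PQ/Pe. Qed.

Lemma for_small_and (P Q : R -> Prop) :
  for_small P -> for_small Q -> for_small (fun e => P e /\ Q e).
Proof.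
move=> [e0 e00 Pe] [e1 e10 Qe]; exists (Num.min e0 e1).
  by rewrite lt_min e00.
by move=> e e2; rewrite le_min => /andP[? ?]; split; [apply: Pe|apply: Qe].
Qed.

Lemma for_small_fin (I : finType) (P : I -> R -> Prop) :
  (forall i, for_small (P i)) -> for_small (fun e => forall i, P i e).
Proof.
move=> sP.
suff [e0 e00 Pe] : for_small (fun e => forall i, i \in enum I -> P i e).
  by exists e0 => // e e1 e2 i; apply: Pe => //; rewrite mem_enum.
elim: (enum I) => [|i s IHs]; first by exists 1.
apply: for_small_imp (for_small_and (sP i) IHs) => e _ [Pi Ps] j.
by rewrite inE => /orP[/eqP ->|/Ps].
Qed.

(** A subset of a finite set is coded by a boolean function on an enumeration, which leaves finitely
    many conditions. *)
Lemma for_small_subsets (T : choiceType) (A : set T) (P : set T -> R -> Prop) :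
    finite_set A -> (forall V, V `<=` A -> for_small (P V)) ->
  for_small (fun e => forall V, V `<=` A -> P V e).
Proof.
move=> /finite_seqP[s ->] sP.
pose U (f : {ffun 'I_(size s) -> bool}) :=
  [set x | exists2 i, f i & x = tnth (in_tuple s) i].
have Us f : U f `<=` [set` s] by move=> _ [i _ ->] /=; exact: mem_tnth.
apply: for_small_imp (for_small_fin (fun f => sP _ (Us f))) => e _ PU V Vs.
suff -> : V = U [ffun i => `[< V (tnth (in_tuple s) i) >]] by [].
apply/seteqP; split=> [x Vx|x [i]]; last by rewrite ffunE => /asboolP Vi ->.
have /tnthP[i xi] : x \in in_tuple s by exact: Vs.
by exists i; rewrite ?ffunE -?xi //; exact/asboolP.
Qed.

End ForSmall.

(** * Short steps against the minimum-norm vector *)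

Section MinimumNormStep.
Variables (R : realType) (n : nat).
Implicit Types (P D Y : set 'cV[R]_n) (u v y z d : 'cV[R]_n).

(** An instance of the variational inequality, as [D] lies in its [hull_cone]. For nonzero [v] it
    makes [- v] a strict descent direction of every slope in [D]. *)
Lemma min_norm_dot D Y y v d :
  min_norm (hull_cone D Y y) v -> D d -> dot v v <= dot d v.
Proof.
move=> mv Dd; rewrite (dotC d).
apply: min_norm_variational mv (sub_hull_cone _ _ Dd); exact: hull_cone_convex.
Qed.

(* The normals of the constraints active at y lie in the normal cone, so v has
   nonnegative product with each of them. *)
Lemma min_norm_step_feasible D Y y v : polyhedron Y -> Y y ->
  min_norm (hull_cone D Y y) v -> for_small (fun e => Y (y - e *: v)).
Proof.
move=> /polyhedronE[k [a [b Yab]]] Yy mv.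
have E e i : dot (a i) (y - e *: v) = dot (a i) y - e * dot (a i) v.
  by rewrite dotBr dotZr.
suff /for_small_fin : forall i, for_small (fun e => dot (a i) (y - e *: v) <= b i).
  by apply: for_small_imp => e _ le; apply/Yab.
move=> i; have := (Yab y).1 Yy i; rewrite le_eqVlt => /orP[/eqP ayb|ayb].
  have av : 0 <= dot (a i) v.
    have Na : normal_cone Y y (a i).
      by move=> z /Yab/(_ i) azb; rewrite dotBr ayb subr_le0.
    have := min_norm_variational (@hull_cone_convex _ _ D Y y) mv
      (hull_coneD mv.1 Na).
    by rewrite dotDr (dotC v (a i)) lerDl.
  exists 1 => // e e0 _; rewrite E ayb gerBl mulr_ge0 //; exact: ltW.
(* An inactive constraint has slack that a step of this length cannot exceed; the [+ 1] keeps the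
   denominator positive. *)
exists ((b i - dot (a i) y) / (`|dot (a i) v| + 1)).
  by rewrite divr_gt0 ?subr_gt0 // ltr_wpDl.
move=> e e0; rewrite ler_pdivlMr ?ltr_wpDl // E.
have := ler_norm (- dot (a i) v); rewrite normrN; nra.
Qed.

(** A point outside [P] violates some constraint by a positive margin, which a short step cannot
    make up. *)
Lemma closed_step P y v : polyhedron P ->
  for_small (fun e => P (y - e *: v) -> P y).
Proof.
move=> /polyhedronE[k [a [b Pab]]].
have [Py|nPy] := pselect (P y); first by exists 1.
have [i ayb] : exists i, b i < dot (a i) y.
  apply: contra_notP nPy => /forallNP no; apply/Pab => i.
  by rewrite leNgt; apply/negP.
exists ((dot (a i) y - b i) / (`|dot (a i) v| + 1) / 2).
  by rewrite !divr_gt0 ?subr_gt0 // ltr_wpDl.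
move=> e e0; rewrite !ler_pdivlMr ?ltr_wpDl // => le /Pab/(_ i).
rewrite dotBr dotZr.
have := ler_norm (dot (a i) v); nra.
Qed.

End MinimumNormStep.

(** * Affine pieces of full dimension and subgradients *)

Section Subgradient.
Variables (R : realType) (n : nat).
Implicit Types (P Y : set 'cV[R]_n) (z : 'cV[R]_n) (F : 'cV[R]_n -> R).

Definition convex_on Y F : Prop :=
  forall u v (t : R), Y u -> Y v -> 0 <= t -> t <= 1 ->
    F (t *: u + (1 - t) *: v) <= t * F u + (1 - t) * F v.

(** The point is a convex combination of [p], with weight [1 - \sum_j mu j], and the points
    [p + m j]. *)
Lemma polyhedron_simplex P k p (m : 'I_k -> 'cV[R]_n) (mu : 'I_k -> R) :
    polyhedron P -> P p -> (forall j, P (p + m j)) ->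
    (forall j, 0 <= mu j) -> \sum_j mu j <= 1 ->
  P (p + \sum_j mu j *: m j).
Proof.
move=> /polyhedronE[l [a [b Pab]]] /Pab Pp Pm mu0 mu1; apply/Pab => i.
have -> : dot (a i) (p + \sum_j mu j *: m j) =
    (1 - \sum_j mu j) * dot (a i) p + \sum_j mu j * dot (a i) (p + m j).
  rewrite dotDr (dotC _ (\sum_j _)) dot_suml mulrBl mul1r mulr_suml -addrA.
  congr (_ + _); rewrite addrC -sumrB; apply: eq_bigr => j _.
  by rewrite dotZl dotDr (dotC (m j)); ring.
have -> : b i = (1 - \sum_j mu j) * b i + \sum_j mu j * b i.
  by rewrite -mulr_suml; ring.
rewrite lerD ?ler_wpM2l ?subr_ge0 //; apply: ler_sum => j _.
by rewrite ler_wpM2l // ((Pab _).1 (Pm j)).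
Qed.

(** A vector [z - p] outside the column span of [M] would give [k + 1] independent directions in
    [Y], against its dimension. *)
Lemma affine_dim_span Y k p (M : 'M[R]_(n, k)) z : affine_dim Y k ->
    Y p -> (forall j, Y (p + col j M)) -> \rank M = k -> Y z ->
  exists u : 'cV[R]_k, z = p + M *m u.
Proof.
move=> [_ maxk] Yp YM rM Yz.
have [/submxP[u zu]|nsub] := boolP ((z - p)^T <= M^T)%MS.
  have zpE : z - p = M *m u^T by rewrite -[z - p]trmxK zu trmx_mul trmxK.
  by exists u^T; rewrite -zpE subrKC.
have rk : (k < \rank (row_mx (z - p) M))%N.
  rewrite -[X in (X < _)%N]rM -mxrank_tr -[X in (_ < X)%N]mxrank_tr tr_row_mx.
  rewrite rank_ltmx // ltmxE -addsmxE addsmxSr /=.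
  by apply: contra nsub; apply: submx_trans; rewrite -addsmxE addsmxSl.
case: maxk; exists p, (row_mx (z - p) M); split=> // [j|].
  case: (split_ordP (j : 'I_(1 + k))) => i ->.
    by rewrite [col _ _](colKl i (z - p) M) ord1 col_id subrKC.
  by rewrite [col _ _](colKr i (z - p) M).
by apply/eqP; rewrite eqn_leq; apply/andP; split=> //; exact: rank_leq_col.
Qed.

(* Extending the segment from z through the barycentre of an affine basis of P
   slightly beyond it stays in P, because P has the dimension of Y. *)
Lemma affine_piece_subgradient P Y F k a (c : R) :
    polyhedron P -> P `<=` Y -> affine_dim P k -> affine_dim Y k ->
    convex_on Y F -> (forall z, P z -> F z = dot a z + c) ->
  forall z, Y z -> dot a z + c <= F z.
Proof.
move=> pP PY [[p [M [Pp PM rM]]] _] dimY cF FP z Yz.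
have YM j : Y (p + col j M) by exact/PY/PM.
have [u zE] := affine_dim_span dimY (PY _ Pp) YM rM Yz.
have mulMx (w : 'cV[R]_k) : M *m w = \sum_j w j 0 *: col j M.
  apply/matrixP => i i'; rewrite ord1 mxE summxE.
  by apply: eq_bigr => j _; rewrite !mxE mulrC.
(* The barycentric weight of the [k + 1] points [p] and [p + col j M]; [w0] below gives their
   barycentre. *)
pose s : R := k.+1%:R^-1.
have s0 : 0 < s by rewrite invr_gt0 ltr0Sn.
have ks : k%:R * s = 1 - s.
  have : k.+1%:R * s = 1 by rewrite mulfV ?pnatr_eq0.
  by rewrite -natr1 mulrDl mul1r; lra.
(* [B] dominates the deviation of every barycentric weight of [z], that of [p] included, so stepping
   back by [t] costs each weight at most [s]. *)
pose B := 1 + \sum_j `|u j 0 - s| + `|\sum_j u j 0 - k%:R * s|.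
have B1 : 1 <= B by rewrite /B -addrA lerDl addr_ge0 ?sumr_ge0.
pose t := s / B.
have B0 : 0 < B by lra.
have t0 : 0 < t by rewrite divr_gt0.
have tB x : `|x| <= B -> t * x <= s.
  move=> xB; rewrite /t mulrAC ler_pdivrMr // ler_wpM2l ?(ltW s0) //.
  exact: le_trans (ler_norm x) xB.
pose w0 : 'cV[R]_k := const_mx s.
pose w1 : 'cV[R]_k := w0 - t *: (u - w0).
have Pw (w : 'cV[R]_k) : (forall j, 0 <= w j 0) -> \sum_j w j 0 <= 1 ->
    P (p + M *m w).
  by move=> w00 w01; rewrite mulMx; exact: polyhedron_simplex.
have sum0 : \sum_j w0 j 0 = k%:R * s.
  by under eq_bigr do rewrite mxE; rewrite sumr_const card_ord mulr_natl.
have Pw0 : P (p + M *m w0).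
  by apply: Pw => [j|]; rewrite ?mxE ?(ltW s0) // sum0; lra.
have Pw1 : P (p + M *m w1).
  have w1E j : w1 j 0 = s - t * (u j 0 - s) by rewrite !mxE.
  apply: Pw => [j|].
    rewrite w1E subr_ge0 tB // /B (bigD1 j) //=.
    have : 0 <= \sum_(i < k | i != j) `|u i 0 - s| by exact: sumr_ge0.
    have := normr_ge0 (\sum_j u j 0 - k%:R * s); lra.
  under eq_bigr do rewrite w1E.
  rewrite sumrB -mulr_sumr sumrB sumr_const card_ord -(mulr_natl s) ks.
  have : t * - (\sum_j u j 0 - k%:R * s) <= s.
    apply: tB; rewrite normrN /B.
    have : 0 <= \sum_j `|u j 0 - s| by exact: sumr_ge0.
    lra.
  by rewrite ks; lra.
(* Chosen so that [r = (1 - r) * t], which puts the barycentre on the segment from [z] to the point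
   of [w1]. *)
pose r := t / (1 + t).
have r0 : 0 < r by rewrite divr_gt0 // addr_gt0.
have r1 : r * (1 + t) = t by rewrite mulfVK // gt_eqF // addr_gt0.
have r2 : r <= 1 by rewrite ler_pdivrMr ?addr_gt0 //; lra.
have xw : p + M *m w0 = r *: z + (1 - r) *: (p + M *m w1).
  apply/matrixP => i i'; rewrite ord1 zE /w1 mulmxBr -scalemxAr mulmxBr.
  move: (M *m u) (M *m w0) => mu mw; rewrite !mxE.
  have : r - (1 - r) * t = 0 by lra.
  move=> /(congr1 (fun q => q * (mu i 0 - mw i 0))); rewrite mul0r; lra.
(* [F] equals the affine function at the barycentre and at the point of [w1], so convexity leaves
   the claim at [z] multiplied by [r]. *)
have := cF z (p + M *m w1) r Yz (PY _ Pw1) (ltW r0) r2.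
rewrite -xw (FP _ Pw0) (FP _ Pw1) xw !(dotDr, dotZr) => H.
by rewrite -(ler_pM2l r0); lra.
Qed.

End Subgradient.

(** * Linear constraints as polyhedra *)

Section AffineConstraints.
Variables (R : realType) (n k : nat).
Implicit Types (M : 'M[R]_(k, n)) (b u v : 'cV[R]_k).

Let oppcE u i : (- u) i 0 = - u i 0.
Proof. by rewrite mxE. Qed.

Lemma polyhedron_ge M b : polyhedron [set z : 'cV[R]_n | levec b (M *m z)].
Proof.
have -> : [set z | levec b (M *m z)] = [set z | levec (- M *m z) (- b)].
  by apply/seteqP; split=> z /= le i; have := le i; rewrite mulNmx !oppcE lerN2.
exact: polyhedron_le.
Qed.

Lemma levec_eq u v : levec u v -> levec v u -> u = v.
Proof.
move=> uv vu; apply/matrixP => i j; rewrite ord1.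
by apply/le_anti; rewrite uv vu.
Qed.

Lemma levec_convex (u0 u1 v0 v1 : 'cV[R]_k) (t : R) : 0 <= t -> t <= 1 ->
  levec u0 v0 -> levec u1 v1 ->
  levec (t *: u0 + (1 - t) *: u1) (t *: v0 + (1 - t) *: v1).
Proof.
move=> t0 t1 uv0 uv1 i; rewrite !mxE lerD // ler_wpM2l ?uv0 ?uv1 //.
by rewrite subr_ge0.
Qed.

Lemma dot_ge_box b u v (c : 'cV[R]_k) : levec b u -> levec u v ->
  - (\sum_i `|c i 0| * (`|b i 0| + `|v i 0|)) <= dot c u.
Proof.
move=> bu uv; rewrite dotE -sumrN; apply: ler_sum => i _.
rewrite lerNl (le_trans (ler_norm _)) // normrN normrM ler_wpM2l //.
have := bu i; have := uv i; rewrite ler_norml.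
have := ler_norm (v i 0); have := ler_norm (- b i 0); rewrite normrN.
have := normr_ge0 (v i 0); have := normr_ge0 (b i 0).
by move=> ? ? ? ? ? ?; apply/andP; split; lra.
Qed.

Lemma dot_mulmx M (c : 'cV[R]_k) z : dot c (M *m z) = dot (M^T *m c) z.
Proof. by rewrite /dot mulmxA trmx_mul trmxK. Qed.

Lemma polyhedron_eq M b : polyhedron [set z : 'cV[R]_n | M *m z = b].
Proof.
have -> : [set z | M *m z = b] =
    [set z | levec (M *m z) b] `&` [set z | levec b (M *m z)].
  apply/seteqP; split=> z /= => [->|[]]; last exact: levec_eq.
  by split=> i.
by apply: polyhedronI; [exact: polyhedron_le | exact: polyhedron_ge].
Qed.

End AffineConstraints.

(** * Attained minima and maxima of sets of reals *)

Section SetExtrema.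
Variable R : realType.
Implicit Types (S : set R) (m : R).

Lemma set_minE S m : is_least S m -> set_min S = m.
Proof.
move=> leastm; rewrite /set_min; case: xgetP => [m' _ [Sm' lbm']|/(_ m) //].
by case: leastm => Sm lbm; apply/le_anti; rewrite lbm' // lbm.
Qed.

Lemma set_maxE S m : is_greatest S m -> set_max S = m.
Proof.
move=> greatestm; rewrite /set_max; case: xgetP => [m' _ [Sm' ubm']|/(_ m) //].
by case: greatestm => Sm ubm; apply/le_anti; rewrite ubm // ubm'.
Qed.

End SetExtrema.

(** * The dispatch problem of one area *)

Section AreaValue.
Variables (R : realType) (n m m' l : nat) (A : area R n m m' l).
Implicit Types (own : 'cV[R]_m) (other : 'cV[R]_m').
Implicit Types (xi : 'cV[R]_(n + (n + n))) (x : dispatch R n).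

(** Stacking a dispatch into one vector makes the linear programming results applicable. *)
Let dispatch_of (z : 'cV[R]_(n + (n + (n + n)))) : dispatch R n :=
  Dispatch (usubmx z) (usubmx (dsubmx z)) (usubmx (dsubmx (dsubmx z)))
    (dsubmx (dsubmx (dsubmx z))).

Let Eg : 'M[R]_(n, n + (n + (n + n))) := usubmx 1%:M.
Let Ew : 'M[R]_(n, n + (n + (n + n))) := usubmx (dsubmx 1%:M).
Let El : 'M[R]_(n, n + (n + (n + n))) := usubmx (dsubmx (dsubmx 1%:M)).
Let Et : 'M[R]_(n, n + (n + (n + n))) := dsubmx (dsubmx (dsubmx 1%:M)).

Let dispatch_ofE z :
  dispatch_of z = Dispatch (Eg *m z) (Ew *m z) (El *m z) (Et *m z).
Proof. by rewrite /Eg /Ew /El /Et !(mul_usub_mx, mul_dsub_mx) mul1mx. Qed.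

Let balance (X Y G W L : 'cV[R]_n) :
  X - G - W + L = - Y <-> X + Y = G + W - L.
Proof.
by split=> /matrixP e; apply/matrixP => i j; have := e i j; rewrite !mxE; lra.
Qed.

Let polyhedron_feasible own other xi :
  polyhedron [set z | feasible A own other xi (dispatch_of z)].
Proof.
have -> : [set z | feasible A own other xi (dispatch_of z)] =
    [set z | (B_ii A *m Et - Eg - Ew + El) *m z = - (B_ib A *m own)] `&`
    [set z | (B_bi A *m Et) *m z = - (B_bb A *m own + B_bb' A *m other)] `&`
    ([set z | levec (Gmin A) (Eg *m z)] `&` [set z | levec (Eg *m z) (Gmax A)]) `&`
    ([set z | levec 0 (Ew *m z)] `&` [set z | levec (Ew *m z) (Wmax xi)]) `&`
    ([set z | levec (Dmin xi) (El *m z)] `&` [set z | levec (El *m z) (Dmax xi)]) `&`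
    [set z | levec ((H_i A *m Et) *m z) (f_lim A - H_b A *m own)].
  apply/seteqP; split=> z; rewrite /= dispatch_ofE.
    move=> [[/= e1 e2] [/= ? ? ?] /= ll]; do !split=> //.
    - by rewrite mulmxDl !mulmxBl -mulmxA; exact/balance.
    - by rewrite -mulmxA; apply/eqP; rewrite -subr_eq0 opprK addrA e2.
    - by move=> i; have := ll i; rewrite -mulmxA !mxE lerBrDr.
  move=> [[[[[e1 e2] [? ?]] [? ?]] [? ?]] ll]; split; [split|split=> //|] => /=.
  - by move: e1; rewrite /= mulmxDl !mulmxBl -mulmxA => /balance.
  - by rewrite mulmxA -addrA e2 addNr.
  - by move=> i; have := ll i; rewrite -mulmxA !mxE lerBrDr.
repeat apply: polyhedronI; by [exact: polyhedron_eq | exact: polyhedron_le |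
  exact: polyhedron_ge].
Qed.

Let cost_dispatch_of xi z : cost A xi (dispatch_of z) =
  dot (Eg^T *m P_g A - Ew^T *m P_w A - El^T *m P_d A) z
    + (dot (P_w A) (Wmax xi) + dot (P_d A) (Dmax xi)).
Proof.
by rewrite /cost dispatch_ofE /= !(dotBr, dotBl) !dot_mulmx; ring.
Qed.

(** The phase angles carry no cost, and the priced variables lie in boxes, so the cost is bounded
    below for prices of either sign. *)
Let cost_ge own other xi :
  exists L, forall x, feasible A own other xi x -> L <= cost A xi x.
Proof.
eexists => x [_ [[g1 g2] [w1 w2] [d1 d2]] _]; rewrite /cost !dotBr.
have := dot_ge_box (P_g A) g1 g2.
have := dot_ge_box (- P_w A) w1 w2; have := dot_ge_box (- P_d A) d1 d2.
rewrite !dotNl => Hd Hw Hg.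
(* The bound left open by [eexists] becomes this sum, in which [x] does not occur. *)
apply: le_trans (lerD (lerD Hg (lerD (lexx (dot (P_w A) (Wmax xi))) Hw))
  (lerD (lexx (dot (P_d A) (Dmax xi))) Hd)); exact: lexx.
Qed.

(** Feasibility and the lower bound make the linear program attain its minimum, so [Jarea] is a true
    minimum rather than the default of [set_min]. *)
Lemma Jarea_attained own other xi : (exists x, feasible A own other xi x) ->
  exists x, [/\ feasible A own other xi x, cost A xi x = Jarea A own other xi &
    forall x', feasible A own other xi x' -> Jarea A own other xi <= cost A xi x'].
Proof.
have dispatchK x : exists z, dispatch_of z = x.
  case: x => g w d th; exists (col_mx g (col_mx w (col_mx d th))).
  by rewrite /dispatch_of !(col_mxKu, col_mxKd).
move=> [x0 fx0]; have [z0 z0x] := dispatchK x0.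
have [L Lcost] := cost_ge own other xi.
pose K := dot (P_w A) (Wmax xi) + dot (P_d A) (Dmax xi).
have [||z [fz zmin]] := @polyhedron_min _ _ _
    (Eg^T *m P_g A - Ew^T *m P_w A - El^T *m P_d A) (L - K)
    (polyhedron_feasible own other xi).
- by exists z0; rewrite /= z0x.
- by move=> z /Lcost; rewrite cost_dispatch_of -/K => ?; lra.
have zleast x' : feasible A own other xi x' ->
    cost A xi (dispatch_of z) <= cost A xi x'.
  by have [z' <- fz'] := dispatchK x'; rewrite !cost_dispatch_of lerD2r zmin.
have JE : Jarea A own other xi = cost A xi (dispatch_of z).
  apply: set_minE; split; first by exists (dispatch_of z).
  by move=> _ [x' /zleast lex' <-].
by exists (dispatch_of z); rewrite JE.
Qed.

(** The constraints are jointly affine in boundary angles, scenario and dispatch, so the mixed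
    dispatch suits the mixed data; the cost mixes likewise. *)
Lemma feasible_convex own0 own1 other0 other1 xi0 xi1 x0 x1 (t : R) :
    0 <= t -> t <= 1 ->
    feasible A own0 other0 xi0 x0 -> feasible A own1 other1 xi1 x1 ->
  exists x, feasible A (t *: own0 + (1 - t) *: own1)
      (t *: other0 + (1 - t) *: other1) (t *: xi0 + (1 - t) *: xi1) x /\
    cost A (t *: xi0 + (1 - t) *: xi1) x =
      t * cost A xi0 x0 + (1 - t) * cost A xi1 x1.
Proof.
move=> t0 t1.
have subL k1 k2 (a b : 'cV[R]_(k1 + k2)) :
    (usubmx (t *: a + (1 - t) *: b) = t *: usubmx a + (1 - t) *: usubmx b) *
    (dsubmx (t *: a + (1 - t) *: b) = t *: dsubmx a + (1 - t) *: dsubmx b).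
  by split; apply/matrixP => i j; rewrite !mxE.
have mulL p q (M : 'M[R]_(p, q)) a b :
    M *m (t *: a + (1 - t) *: b) = t *: (M *m a) + (1 - t) *: (M *m b).
  by rewrite mulmxDr -!scalemxAr.
pose mix k (a b : 'cV[R]_k) := t *: a + (1 - t) *: b.
case: x0 => g0 w0 d0 h0 [[/= e0 e0'] [/= [? ?] [? ?] [? ?]] /= ll0].
case: x1 => g1 w1 d1 h1 [[/= e1 e1'] [/= [? ?] [? ?] [? ?]] /= ll1].
exists (Dispatch (mix _ g0 g1) (mix _ w0 w1) (mix _ d0 d1) (mix _ h0 h1)).
have mixC k (a : 'cV[R]_k) : a = mix _ a a.
  by rewrite /mix -scalerDl subrKC scale1r.
have mixD k (a a' b b' : 'cV[R]_k) :
    mix _ (a + a') (b + b') = mix _ a b + mix _ a' b'.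
  by rewrite /mix !scalerDr addrACA.
have mixN k (a b : 'cV[R]_k) : mix _ (- a) (- b) = - mix _ a b.
  by rewrite /mix !scalerN -opprD.
have mix_le k (a a' b b' : 'cV[R]_k) :
    levec a a' -> levec b b' -> levec (mix _ a b) (mix _ a' b').
  exact: levec_convex.
split; last first.
  rewrite /cost /= /Wmax /Dmax !subL /mix !(dotDr, dotNr, dotZr); ring.
split.
- split=> /=; rewrite /mix !mulL -!/(mix _ _ _).
    by rewrite -mixD e0 e1 !mixD !mixN.
  by rewrite -!mixD e0' e1' -mixC.
- split=> /=; rewrite /Wmax /Dmin /Dmax ?subL; split; try exact: mix_le.
  + by rewrite (mixC _ (Gmin A)); apply: mix_le.
  + by rewrite (mixC _ (Gmax A)); apply: mix_le.
  + by rewrite (mixC _ 0); apply: mix_le.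
- rewrite /line_limits /= /mix !mulL -!/(mix _ _ _) -mixD (mixC _ (f_lim A)).
  exact: mix_le.
Qed.

(** Mixing two optimal dispatches gives a feasible one whose cost is the right-hand side. *)
Lemma Jarea_convex own0 own1 other0 other1 xi0 xi1 (t : R) :
    0 <= t -> t <= 1 ->
    (exists x, feasible A own0 other0 xi0 x) ->
    (exists x, feasible A own1 other1 xi1 x) ->
  Jarea A (t *: own0 + (1 - t) *: own1) (t *: other0 + (1 - t) *: other1)
      (t *: xi0 + (1 - t) *: xi1)
    <= t * Jarea A own0 other0 xi0 + (1 - t) * Jarea A own1 other1 xi1.
Proof.
move=> t0 t1 /Jarea_attained[x0 [f0 <- _]] /Jarea_attained[x1 [f1 <- _]].
have [x [fx <-]] := feasible_convex t0 t1 f0 f1.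
by have [_ [_ _]] := Jarea_attained (ex_intro _ _ fx); apply.
Qed.

End AreaValue.

(** * Worst case over a set of scenarios *)

Section WorstCase.
Variables (R : realType) (N q : nat) (J : 'cV[R]_N -> 'cV[R]_q -> R).
Implicit Types (V : set 'cV[R]_q) (y : 'cV[R]_N) (Y : set 'cV[R]_N).

Lemma finite_max (T : choiceType) (V : set T) (f : T -> R) :
  finite_set V -> V !=set0 -> exists x, V x /\ forall x', V x' -> f x' <= f x.
Proof.
move=> /finite_seqP[s ->] [x0 /= xs0].
have /tnthP[i0 _] : x0 \in in_tuple s by [].
have [i _ imax] := @Order.TotalTheory.arg_maxP _ _ _ i0 xpredT
  (fun i => f (tnth (in_tuple s) i)) isT.
exists (tnth (in_tuple s) i); split; first exact: mem_tnth.
by move=> x' /= xs'; have /tnthP[j ->] : x' \in in_tuple s by []; exact: imax.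
Qed.

Lemma worst_caseE V y xi : V xi -> (forall xi', V xi' -> J y xi' <= J y xi) ->
  worst_case J V y = J y xi.
Proof.
move=> Vxi ximax; apply: set_maxE.
by split; [exists xi | move=> _ [xi' /ximax ? <-]].
Qed.

Lemma worst_case_attained V y : finite_set V -> V !=set0 ->
  exists xi, [/\ V xi, worst_case J V y = J y xi &
    forall xi', V xi' -> J y xi' <= worst_case J V y].
Proof.
move=> fV V0; have [xi [Vxi ximax]] := finite_max (J y) fV V0.
by exists xi; rewrite (worst_caseE Vxi ximax).
Qed.

(** A scenario that is worst at the mixture obeys its own convexity inequality, and the maxima at
    [u] and [v] bound its values there. *)
Lemma worst_case_convex Y V : is_convex Y -> finite_set V -> V !=set0 ->
  (forall xi, V xi -> convex_on Y (J^~ xi)) -> convex_on Y (worst_case J V).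
Proof.
move=> cY fV V0 cJ u v t Yu Yv t0 t1.
have [xi [Vxi -> _]] := worst_case_attained (t *: u + (1 - t) *: v) fV V0.
have [_ [_ _ umax]] := worst_case_attained u fV V0.
have [_ [_ _ vmax]] := worst_case_attained v fV V0.
apply: le_trans (cJ xi Vxi u v t Yu Yv t0 t1) _.
by rewrite lerD // ler_wpM2l ?umax ?vmax // subr_ge0.
Qed.

End WorstCase.

(** * Vertices of a box and maxima of convex functions *)

Section Box.
Variables (R : realType) (q : nat) (lo hi : 'cV[R]_q).
Hypothesis lohi : levec lo hi.
Implicit Types (x u v : 'cV[R]_q).

Let box := [set x | levec lo x /\ levec x hi].
Let extreme x i := (x i 0 == lo i 0) || (x i 0 == hi i 0).

Let shiftE x i (r : R) j :
  (x + r *: delta_mx i 0) j 0 = x j 0 + r * (j == i)%:R.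
Proof. by rewrite !mxE eqxx andbT. Qed.

Lemma box_vertex_extreme x i :
  vertex box x -> (x i 0 == lo i 0) || (x i 0 == hi i 0).
Proof.
move=> [[lox xhi] xvert]; apply/negPn/negP; rewrite negb_or => /andP[xl xh].
have lti : lo i 0 < x i 0 by rewrite lt_neqAle eq_sym xl lox.
have ltx : x i 0 < hi i 0 by rewrite lt_neqAle xh xhi.
(* [x] is the midpoint of the two points at distance [d] along coordinate [i], and both stay in the
   box. *)
pose d := Num.min (x i 0 - lo i 0) (hi i 0 - x i 0).
have d0 : 0 < d by rewrite lt_min !subr_gt0 lti.
have dl : d <= x i 0 - lo i 0 by rewrite ge_min lexx.
have dh : d <= hi i 0 - x i 0 by rewrite ge_min lexx orbT.
have near r : `|r| <= d -> box (x + r *: delta_mx i 0).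
  rewrite ler_norml => /andP[r1 r2].
  split=> j; rewrite shiftE; have [->|ji] := eqVneq j i.
  - by rewrite mulr1; lra.
  - by rewrite mulr0 addr0.
  - by rewrite mulr1; lra.
  - by rewrite mulr0 addr0.
have := xvert (x + d *: delta_mx i 0) (x + (- d) *: delta_mx i 0) 2^-1.
case=> [||||/matrixP/(_ i 0) xd _].
- by apply: near; rewrite gtr0_norm.
- by apply: near; rewrite normrN gtr0_norm.
- by apply/andP; split; lra.
- apply/matrixP => j k; rewrite !mxE; lra.
by move: xd; rewrite shiftE eqxx mulr1; lra.
Qed.

Lemma extreme_box_vertex x :
  box x -> (forall i, (x i 0 == lo i 0) || (x i 0 == hi i 0)) -> vertex box x.
Proof.
move=> bx ex; split=> // u v t [lou uhi] [lov vhi] /andP[t0 t1] xE.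
have uvx i : u i 0 = x i 0 /\ v i 0 = x i 0.
  have xi : x i 0 = t * u i 0 + (1 - t) * v i 0 by rewrite xE !mxE.
  have := lou i; have := uhi i; have := lov i; have := vhi i.
  by have /orP[/eqP e|/eqP e] := ex i; rewrite e in xi *; split; nra.
by split; apply/matrixP => i j; rewrite ord1; case: (uvx i).
Qed.

(** Every vertex is a corner, and corners are coded by boolean functions on the coordinates. *)
Lemma finite_box_vertex : finite_set (vertex box).
Proof.
pose corner (f : {ffun 'I_q -> bool}) : 'cV[R]_q :=
  \col_i (if f i then lo i 0 else hi i 0).
apply: (@sub_finite_set _ _ [set` [seq corner f | f <- enum {ffun 'I_q -> bool}]]);
  last by apply/finite_seqP; eexists.
move=> x /box_vertex_extreme ex /=; apply/mapP.
exists [ffun i => x i 0 == lo i 0]; first by rewrite mem_enum.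
apply/matrixP => i j; rewrite ord1 mxE ffunE.
by have /orP[/eqP ->|/eqP e] := ex i; rewrite ?eqxx //; case: eqP.
Qed.

(** A coordinate strictly between its bounds is pushed to each of them; by convexity one end is at
    least as good, and fewer such coordinates remain. *)
Lemma convex_le_vertex (f : 'cV[R]_q -> R) x : convex_on box f -> box x ->
  exists2 x', vertex box x' & f x <= f x'.
Proof.
move=> cf; have [d] := ubnP #|[pred i | ~~ extreme x i]|.
elim: d x => // d IHd x dx bx.
have [/forallP ex|/forallPn[i nex]] := boolP [forall i, extreme x i].
  by exists x => //; exact: extreme_box_vertex.
have [lox xhi] := bx.
move: (nex); rewrite negb_or => /andP[xl xh].
have lti : lo i 0 < x i 0 by rewrite lt_neqAle eq_sym xl lox.
have ltx : x i 0 < hi i 0 by rewrite lt_neqAle xh xhi.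
pose push (r : R) : 'cV[R]_q := x + (r - x i 0) *: delta_mx i 0.
have pushi r : push r i 0 = r by rewrite shiftE eqxx mulr1 subrKC.
have pushj r j : j != i -> push r j 0 = x j 0.
  by move=> /negbTE ji; rewrite shiftE ji mulr0 addr0.
have bpush r : lo i 0 <= r -> r <= hi i 0 -> box (push r).
  by move=> r1 r2; split=> j; have [->|ji] := eqVneq j i; rewrite ?pushi ?pushj.
have IHpush r : lo i 0 <= r -> r <= hi i 0 -> (r == lo i 0) || (r == hi i 0) ->
    exists2 x', vertex box x' & f (push r) <= f x'.
  move=> r1 r2 er; apply: IHd; last exact: bpush.
  move: dx; rewrite ltnS; apply: leq_trans.
  apply/proper_card/properP; split.
    apply/fintype.subsetP => j; rewrite !inE /extreme.
    by have [->|ji] := eqVneq j i; rewrite ?pushi ?pushj // er.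
  by exists i; rewrite !inE /extreme ?pushi ?er // negb_or xl.
have [|xlo vlo flo] := IHpush _ (lexx _) (lohi i); first by rewrite eqxx.
have [|xhi' vhi fhi] := IHpush _ (lohi i) (lexx _); first by rewrite eqxx orbT.
pose t := (hi i 0 - x i 0) / (hi i 0 - lo i 0).
have hl : 0 < hi i 0 - lo i 0 by rewrite subr_gt0 (lt_trans lti).
have t0 : 0 <= t by rewrite divr_ge0 ?subr_ge0 // ltW.
have t1 : t <= 1 by rewrite ler_pdivrMr // mul1r; lra.
have tE : t * (hi i 0 - lo i 0) = hi i 0 - x i 0 by rewrite mulfVK ?gt_eqF.
have xE : x = t *: push (lo i 0) + (1 - t) *: push (hi i 0).
  apply/matrixP => j k; rewrite ord1 [RHS]mxE ![(_ *: push _) _ _]mxE.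
  by have [->|ji] := eqVneq j i; rewrite ?pushi ?pushj //; lra.
have := cf _ _ t (bpush _ (lexx _) (lohi i)) (bpush _ (lohi i) (lexx _)) t0 t1.
rewrite -xE => fx.
(* If the lower end does not beat [x], convexity with [t < 1] makes the upper end at least as good;
   [t = 1] would put coordinate [i] at its lower bound. *)
have [lt|le] := ltP (f x) (f xlo); first by exists xlo => //; exact: ltW.
exists xhi' => //; move: t1; rewrite le_eqVlt => /orP[/eqP t1|t1].
  by exfalso; rewrite t1 mul1r in tE; lra.
by nra.
Qed.

Lemma box_vertex_nonempty : vertex box !=set0.
Proof.
exists lo; apply: extreme_box_vertex => [|i]; last by rewrite eqxx.
by split.
Qed.

Lemma box_vertex_max (f : 'cV[R]_q -> R) : convex_on box f ->
  exists x, vertex box x /\ forall x', box x' -> f x' <= f x.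
Proof.
move=> cf; have [x [vx xmax]] := finite_max f finite_box_vertex box_vertex_nonempty.
exists x; split=> // x' /(convex_le_vertex cf)[x1 vx1 le1].
by apply: le_trans le1 _; exact: xmax.
Qed.

End Box.

(** * Critical region exploration for fixed scenario sets *)

Section Exploration.
Variables (R : realType) (N : nat) (Y : set 'cV[R]_N).
Variables (F1 F2 : 'cV[R]_N -> R) (C1 C2 : regions R N).
Hypotheses (polyY : polyhedron Y) (convF1 : convex_on Y F1)
  (convF2 : convex_on Y F2).
Hypotheses (regF1 : critical_regions Y F1 C1) (regF2 : critical_regions Y F2 C2).
Implicit Types (y z v : 'cV[R]_N) (D : set 'cV[R]_N).

Let F z := F1 z + F2 z.
(** Pairs of regions index the cells of the common refinement, on which [F] is affine; the index
    alone determines the outcome of the inner linear program. *)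
Let idx := ('I_(nreg C1) * 'I_(nreg C2))%type.
Let alpha (j : idx) := slope C1 j.1 + slope C2 j.2.
Let beta (j : idx) := offset C1 j.1 + offset C2 j.2.
Let P (j : idx) := reg C1 j.1 `&` reg C2 j.2.
Let optimum j := lex_argmin (P j) (alpha j) (beta j).

Lemma region_sub F0 C i : critical_regions Y F0 C -> reg C i `<=` Y.
Proof. by move=> [_ _ -> _] z Ciz; exists i. Qed.

(** The affine function of the region minorizes [F0] on all of [Y] and agrees with it at [y]. *)
Lemma region_subgradient F0 C i y z : critical_regions Y F0 C ->
  convex_on Y F0 -> reg C i y -> Y z ->
  F0 y + dot (slope C i) (z - y) <= F0 z.
Proof.
move=> crF cF Ciy Yz; have [/(_ i)[pC [k [dimC dimY]]] _ _ FC] := crF.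
rewrite (FC _ _ Ciy) dotBr.
have := affine_piece_subgradient (polytope_polyhedron pC) (region_sub (i := i) crF)
  dimC dimY cF (FC i) Yz.
lra.
Qed.

Let polytopeP j : polytope (P j).
Proof.
have [/(_ j.1)[p1 _] _ _ _] := regF1; have [/(_ j.2)[[p2 _] _] _ _ _] := regF2.
exact: polytopeI p1 p2.
Qed.

Let P_sub j : P j `<=` Y.
Proof. by move=> z [/(region_sub regF1)]. Qed.

Let F_on_P j z : P j z -> F z = dot (alpha j) z + beta j.
Proof.
move=> [z1 z2]; have [_ _ _ E1] := regF1; have [_ _ _ E2] := regF2.
by rewrite /F (E1 _ _ z1) (E2 _ _ z2) dotDl /beta; ring.
Qed.

Let subgradient j y z : P j y -> Y z -> F y + dot (alpha j) (z - y) <= F z.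
Proof.
move=> [y1 y2] Yz; rewrite /F dotDl.
have := region_subgradient regF1 convF1 y1 Yz.
by have := region_subgradient regF2 convF2 y2 Yz; lra.
Qed.

Let optimum_value j y J : optimum j y J -> [/\ P j y, Y y & F y = J].
Proof. by move=> [Py -> _ _]; split=> //; [exact: P_sub Py | exact: F_on_P]. Qed.

Let finite_slopes D : D `<=` range alpha -> finite_set D.
Proof.
by move=> /sub_finite_set; apply; apply: finite_image; exact: finite_finset.
Qed.

(* The pairs (y, v) that can occur are determined by a set of slopes and a pair
   of regions, hence finitely many. *)
Definition good_step (e : R) : Prop :=
  forall D, D `<=` range alpha -> forall j y J v, optimum j y J ->
    min_norm (hull_cone D Y y) v ->
    Y (y - e *: v) /\ forall i, P i (y - e *: v) -> P i y.

(** Uniqueness of the lexicographic minimizer and of the minimum-norm element leaves one step to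
    consider for each set of slopes and pair of regions, so finitely many thresholds suffice. *)
Lemma for_small_good_step : for_small good_step.
Proof.
apply: (for_small_subsets (finite_slopes (fun _ => id))) => D _.
apply: for_small_fin => j.
have [[y [J [v [opt mv]]]]|no] := pselect (exists y J v,
    optimum j y J /\ min_norm (hull_cone D Y y) v); last first.
  by exists 1 => // e _ _ y J v opt mv; case: no; exists y, J, v.
have [_ Yy _] := optimum_value opt.
have := for_small_and (min_norm_step_feasible polyY Yy mv)
  (for_small_fin (fun i => closed_step y v (polytope_polyhedron (polytopeP i)))).
apply: for_small_imp => e _ good y' J' v' opt' mv'.
have [yy' _] := lex_argmin_unique opt opt'; rewrite -yy' in mv' *.
by rewrite -(min_norm_unique (hull_cone_convex (y := y)) mv mv').
Qed.

(** The region condition on [D] is what makes the recorded slopes subgradients at [y]. *)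
Definition cre_record y (J : R) D : Prop :=
  [/\ exists j, optimum j y J, D !=set0 &
      forall d, D d -> exists2 j, d = alpha j & P j y].

(** Either a fresh exploration, or one whose point lies a nonzero step away from its best point. *)
Definition cre_invariant (e : R) (s : cre_state R N) : Prop :=
  Y (cre_point s) /\
  ((cre_val s = +oo%E /\ cre_slopes s = set0) \/
   exists J v, [/\ cre_val s = J%:E, cre_record (cre_best s) J (cre_slopes s),
     min_norm (hull_cone (cre_slopes s) Y (cre_best s)) v, v != 0 &
     cre_point s = cre_best s - e *: v]).

(** Together with [unexplored] as second entry, this count forms a lexicographic termination
    measure. *)
Definition improving (val : \bar R) : nat :=
  #|[pred j : idx | `[< exists y J, optimum j y J /\ (J%:E < val)%E >]]|.

Definition unexplored D : nat := #|[pred j : idx | `[< ~ D (alpha j) >]]|.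

(** Lowering the value only removes pairs, and [j] is removed because it does not beat its own
    optimum. *)
Let improving_lt j y J (val : \bar R) : optimum j y J -> (J%:E < val)%E ->
  (improving J%:E < improving val)%N.
Proof.
move=> opt Jval; apply/proper_card/properP; split.
  apply/fintype.subsetP => i; rewrite !inE => -[y' [J' [opt' J'J]]].
  by exists y', J'; split=> //; exact: (lt_trans J'J Jval).
exists j; first by rewrite inE; exists y, J.
apply/asboolP => -[y' [J' [opt']]].
by have [_ ->] := lex_argmin_unique opt opt'; rewrite ltxx.
Qed.

Let unexplored_lt j D : ~ D (alpha j) ->
  (unexplored (D `|` [set alpha j]) < unexplored D)%N.
Proof.
move=> Dj; apply/proper_card/properP; split.
  by apply/fintype.subsetP => i; rewrite !inE => nD Di; apply: nD; left.
exists j; first by rewrite inE.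
by apply/negP => /asboolP nD; apply: nD; right.
Qed.

Let record_new j y J : optimum j y J -> cre_record y J [set alpha j].
Proof.
move=> opt; have [Py _ _] := optimum_value opt; split; first by exists j.
  by exists (alpha j).
by move=> d ->; exists j.
Qed.

Let slopes_sub y J D : cre_record y J D -> D `<=` range alpha.
Proof. by move=> [_ _ Dj] d /Dj[j -> _]; exists j. Qed.

(* Moving against v decreases every recorded slope, whereas a slope whose region
   brings no improvement does not decrease along the step: it is new. *)
Lemma cre_pass_step (e : R) s ybest val D v : 0 < e -> good_step e ->
    cre_invariant e s -> cre_pass Y C1 C2 s ybest val D v ->
  exists J, [/\ val = J%:E, cre_record ybest J D,
    min_norm (hull_cone D Y ybest) v &
    (improving val < improving (cre_val s))%N \/
    val = cre_val s /\ (unexplored D < unexplored (cre_slopes s))%N].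
Proof.
move=> e0 good [_ inv] [j1 [j2 [yopt [Jopt [Ps opt]]]]].
pose j : idx := (j1, j2).
change (P j (cre_point s)) in Ps; change (optimum j yopt Jopt) in opt.
rewrite -/(alpha j); case: ifPn => [lt [-> -> ->] mv|ge [-> -> ->] mv].
  exists Jopt; split=> //; first exact: record_new.
  by left; exact: improving_lt opt lt.
(* A fresh state has value [+oo], which any optimum improves, so it cannot reach this branch. *)
case: inv => [[valoo _]|[J [v0 [valJ rec mv0 v00 ptE]]]].
  by rewrite valoo ltry in ge.
have [[i opti] D0 Dslopes] := rec; have [_ _ FJ] := optimum_value opti.
have [_ Pback] := good _ (slopes_sub rec) _ _ _ _ opti mv0.
(* A small step cannot enter a cell that misses the best point. *)
have Py : P j (cre_best s) by apply: Pback; rewrite -ptE.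
exists J; split=> //.
  split; [by exists i | by exists (alpha j); right |].
  by move=> d [/Dslopes //|->]; exists j.
right; split=> //; apply: unexplored_lt => Dj.
(* Without improvement, the affine function of [j] is no smaller after the step than at the best
   point; a recorded slope would make it strictly smaller. *)
have := min_norm_dot mv0 Dj; have := dot_gt0 v00.
have [_ _ optmin _] := opt; have := optmin _ Ps.
rewrite ptE dotBr dotZr; move: ge; rewrite valJ -leNgt lee_fin -FJ (F_on_P Py).
nra.
Qed.

(** The regions cover [Y], so the point lies in a nonempty cell; a lexicographic minimizer and, [D]
    being finite, a minimum-norm vector then exist. *)
Lemma cre_pass_exists (e : R) s : cre_invariant e s ->
  exists ybest val D v, cre_pass Y C1 C2 s ybest val D v.
Proof.
move=> [Ys inv]; have [_ _ Y1 _] := regF1; have [_ _ Y2 _] := regF2.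
have [j1 Cj1] : exists j1, reg C1 j1 (cre_point s) by rewrite Y1 in Ys.
have [j2 Cj2] : exists j2, reg C2 j2 (cre_point s) by rewrite Y2 in Ys.
pose j : idx := (j1, j2).
have [||yopt [Jopt opt]] := @lex_argmin_exists _ _ (P j) (alpha j) (beta j).
- exact: polytopeP.
- by exists (cre_point s).
pose out := if (Jopt%:E < cre_val s)%E then (yopt, Jopt%:E, [set alpha j])
  else (cre_best s, cre_val s, cre_slopes s `|` [set alpha j]).
have [finD D0] : finite_set out.2 /\ out.2 !=set0.
  rewrite /out; case: ifP => _ /=; split.
  - exact: finite_set1.
  - by exists (alpha j).
  - rewrite finite_setU; split; last exact: finite_set1.
    case: inv => [[_ ->]|[J [v [_ rec _ _ _]]]]; first exact: finite_set0.
    exact/finite_slopes/(slopes_sub rec).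
  - by exists (alpha j); right.
have [v mv] := min_norm_exists Y out.1.1 finD D0.
exists out.1.1, out.1.2, out.2, v, j1, j2, yopt, Jopt; split=> //.
by rewrite -!surjective_pairing.
Qed.

(** A zero direction makes a convex combination of slopes equal to [- p] with [p] normal to [Y] at
    [y]; averaging the subgradient inequalities gives optimality. *)
Lemma cre_record_optimal y J D : cre_record y J D ->
  min_norm (hull_cone D Y y) 0 ->
  [/\ Y y, F1 y + F2 y = J & forall z, Y z -> F1 y + F2 y <= F1 z + F2 z].
Proof.
move=> [[j opt] _ Dslopes] [[d Dd [p Np dp]] _].
have [_ Yy FJ] := optimum_value opt; split=> // z Yz.
case: Dd dp => k [c [q [Dq c0 c1 ->]]] dp.
have : \sum_i c i * (F y + dot (q i) (z - y)) <= \sum_i c i * F z.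
  apply: ler_sum => i _; rewrite ler_wpM2l //.
  by have [j' -> Pj'] := Dslopes _ (Dq i); exact: subgradient.
rewrite -mulr_suml c1 mul1r.
under eq_bigr do rewrite mulrDr -dotZl.
rewrite big_split /= -mulr_suml c1 mul1r -dot_suml.
have -> : \sum_i c i *: q i = - p by rewrite -(addr0_eq dp) opprK.
have := Np z Yz; rewrite dotNl /F; lra.
Qed.

Lemma cre_init_invariant (e : R) s : cre_init Y s -> cre_invariant e s.
Proof. by move=> [Ys ? ?]; split=> //; left. Qed.

Lemma cre_continue_invariant (e : R) y J D v : good_step e -> cre_record y J D ->
  min_norm (hull_cone D Y y) v -> v != 0 ->
  cre_invariant e (CreState (y - e *: v) y J%:E D).
Proof.
move=> good rec mv v0; split; last by right; exists J, v.
have [[j opt] _ _] := rec.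
by have [] := good _ (slopes_sub rec) _ _ _ _ opt mv.
Qed.

End Exploration.

(** * Termination and correctness of robust scheduling *)

Section Termination.
Variables (R : realType) (N q1 q2 : nat) (Y : set 'cV[R]_N).
Variables (Xi1 : set 'cV[R]_q1) (Xi2 : set 'cV[R]_q2).
Variables (G1 : 'cV[R]_N -> 'cV[R]_q1 -> R) (G2 : 'cV[R]_N -> 'cV[R]_q2 -> R).
Variables (C1 : set 'cV[R]_q1 -> regions R N) (C2 : set 'cV[R]_q2 -> regions R N).
Hypotheses (polyY : polyhedron Y) (Y0 : Y !=set0).
Hypotheses (finV1 : finite_set (vertex Xi1)) (finV2 : finite_set (vertex Xi2)).
Hypotheses (convG1 : forall xi, vertex Xi1 xi -> convex_on Y (G1^~ xi))
  (convG2 : forall xi, vertex Xi2 xi -> convex_on Y (G2^~ xi)).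
Hypotheses (maxG1 : forall y, Y y -> exists xi, vertex_maximizer Xi1 G1 y xi)
  (maxG2 : forall y, Y y -> exists xi, vertex_maximizer Xi2 G2 y xi).
Hypotheses
  (regG1 : forall V, V !=set0 -> V `<=` vertex Xi1 ->
     critical_regions Y (worst_case G1 V) (C1 V))
  (regG2 : forall V, V !=set0 -> V `<=` vertex Xi2 ->
     critical_regions Y (worst_case G2 V) (C2 V)).

Let state := rs_state R N q1 q2.
Let robust y := worst_case G1 Xi1 y + worst_case G2 Xi2 y.
Let step := rs_step Y Xi1 Xi2 G1 G2 C1 C2.

Let scenarios (q : nat) (Xi V : set 'cV[R]_q) := V !=set0 /\ V `<=` vertex Xi.

Let good (e : R) := forall V1 V2, scenarios Xi1 V1 -> scenarios Xi2 V2 ->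
  good_step Y (C1 V1) (C2 V2) e.

Let for_small_good : for_small good.
Proof.
have : for_small (fun e => forall V1, V1 `<=` vertex Xi1 ->
    forall V2, V2 `<=` vertex Xi2 -> V1 !=set0 -> V2 !=set0 ->
    good_step Y (C1 V1) (C2 V2) e).
  apply: for_small_subsets => // V1 V1x; apply: for_small_subsets => // V2 V2x.
  have [V10|] := pselect (V1 !=set0); last by exists 1.
  have [V20|] := pselect (V2 !=set0); last by exists 1.
  have := for_small_good_step polyY (regG1 V10 V1x) (regG2 V20 V2x).
  exact: for_small_imp.
by apply: for_small_imp => e _ ge V1 V2 [? ?] [? ?]; exact: ge.
Qed.

Let worst_case_conv (q : nat) (Xi V : set 'cV[R]_q)
    (G : 'cV[R]_N -> 'cV[R]_q -> R) : finite_set (vertex Xi) ->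
  (forall xi, vertex Xi xi -> convex_on Y (G^~ xi)) -> scenarios Xi V ->
  convex_on Y (worst_case G V).
Proof.
move=> fXi cG [V0 VXi]; apply: worst_case_convex => //.
- exact: polyhedron_convex.
- exact: sub_finite_set fXi.
- by move=> xi /VXi/cG.
Qed.

Let worst_case_vertex (q : nat) (Xi : set 'cV[R]_q)
    (G : 'cV[R]_N -> 'cV[R]_q -> R) y xi :
  vertex_maximizer Xi G y xi -> worst_case G Xi y = G y xi.
Proof. by move=> [[Xixi _] ximax]; exact: worst_caseE. Qed.

(** Keeping only the scenarios in [V] is a relaxation; this gives the lower bound used at
    termination. *)
Let worst_case_mono (q : nat) (Xi V : set 'cV[R]_q)
    (G : 'cV[R]_N -> 'cV[R]_q -> R) y :
  finite_set (vertex Xi) -> (exists xi, vertex_maximizer Xi G y xi) ->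
  scenarios Xi V -> worst_case G V y <= worst_case G Xi y.
Proof.
move=> fXi [xi mxi] [V0 VXi]; rewrite (worst_case_vertex mxi).
have [xi' [Vxi' -> _]] := worst_case_attained G y (sub_finite_set VXi fXi) V0.
by case: mxi => _; apply; case: (VXi _ Vxi').
Qed.

Let invariant (e : R) (s : state) : Prop :=
  match s with
  | Explore V1 V2 c => [/\ scenarios Xi1 V1, scenarios Xi2 V2 &
      cre_invariant Y (C1 V1) (C2 V2) e c]
  | Assess V1 V2 y J => [/\ scenarios Xi1 V1, scenarios Xi2 V2, Y y,
      J = (worst_case G1 V1 y + worst_case G2 V2 y)%:E &
      forall z, Y z -> worst_case G1 V1 y + worst_case G2 V2 y <=
                       worst_case G1 V1 z + worst_case G2 V2 z]
  | Done y => is_minimizer Y robust y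
  end.

Let vertices1 := sval (cid ((finite_seqP _).1 finV1)).
Let vertices2 := sval (cid ((finite_seqP _).1 finV2)).

Let missing (q : nat) (s : seq 'cV[R]_q) (V : set 'cV[R]_q) : nat :=
  count (fun xi => `[< ~ V xi >]) s.

Let missing_le (q : nat) (s : seq 'cV[R]_q) V xi :
  (missing s (V `|` [set xi]) <= missing s V)%N.
Proof.
by apply: sub_count => x /asboolP nV; apply/asboolP => Vx; apply: nV; left.
Qed.

Let missing_lt (q : nat) (s : seq 'cV[R]_q) V xi : xi \in s -> ~ V xi ->
  (missing s (V `|` [set xi]) < missing s V)%N.
Proof.
elim: s => // x s IHs; rewrite inE => /orP[/eqP <-|xs] nV /=.
  have -> : `[< ~ V xi >] = true by apply/asboolP.
  have -> : `[< ~ (V `|` [set xi]) xi >] = false.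
    by apply/negP => /asboolP; apply; right.
  by rewrite add0n add1n ltnS; exact: missing_le.
rewrite -addnS; apply: leq_add; last exact: IHs.
case: asboolP => // nVx; case: asboolP => // nnVx.
by case: nnVx => Vx; apply: nVx; left.
Qed.

(** Doubling leaves room for two phases per round: a new vertex lowers the rank by at least two,
    more than the one regained on returning to exploration. *)
Let phase (s : state) : nat :=
  match s with
  | Explore V1 V2 _ => ((missing vertices1 V1 + missing vertices2 V2).*2).+2
  | Assess V1 V2 _ _ => ((missing vertices1 V1 + missing vertices2 V2).*2).+1
  | Done _ => 0
  end.

Let values_left (s : state) : nat :=
  if s is Explore V1 V2 c then improving (C1 V1) (C2 V2) (cre_val c) else 0.

Let slopes_left (s : state) : nat :=
  if s is Explore V1 V2 c then unexplored (C1 V1) (C2 V2) (cre_slopes c) else 0.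

(** Lexicographic order on the phase, the cells that can still improve the value, and the slopes not
    yet recorded. *)
Let decreases (s s' : state) : Prop :=
  (phase s' < phase s)%N \/ phase s' = phase s /\
  ((values_left s' < values_left s)%N \/ values_left s' = values_left s /\
   (slopes_left s' < slopes_left s)%N).

Let step_invariant e s s' : 0 < e -> good e -> invariant e s -> step e s s' ->
  invariant e s' /\ decreases s s'.
Proof.
move=> e0 ge inv st; case: st inv.
- move=> V1 V2 c ybest val D v pass v0 [sV1 sV2 inv].
  have [J [-> rec mv dec]] := cre_pass_step (regG1 sV1.1 sV1.2) (regG2 sV2.1 sV2.2)
    e0 (ge _ _ sV1 sV2) inv pass.
  split.
    split=> //; exact: cre_continue_invariant (ge _ _ sV1 sV2) rec mv v0.
  by right; split=> //=; case: dec => [|[-> ?]]; [left | right].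
- move=> V1 V2 c ybest val D v pass v0 [sV1 sV2 inv].
  have [J [-> rec mv _]] := cre_pass_step (regG1 sV1.1 sV1.2) (regG2 sV2.1 sV2.2)
    e0 (ge _ _ sV1 sV2) inv pass.
  rewrite v0 in mv.
  have [Yy FJ ymin] := cre_record_optimal (worst_case_conv finV1 convG1 sV1)
    (worst_case_conv finV2 convG2 sV2)
    (regG1 sV1.1 sV1.2) (regG2 sV2.1 sV2.2) rec mv.
  by split; [rewrite /= -FJ | left => /=].
- move=> V1 V2 y J xi1 xi2 c m1 m2 lt ci [sV1 sV2 Yy JE ymin].
  have sU (q : nat) (Xi V : set 'cV[R]_q) xi :
      scenarios Xi V -> vertex Xi xi -> scenarios Xi (V `|` [set xi]).
    move=> [[x Vx] VXi] vxi; split; first by exists x; left.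
    by move=> x' [/VXi //|->].
  split.
    split; [exact: sU m1.1 | exact: sU m2.1 | exact: cre_init_invariant].
  left; rewrite /= ltnS -doubleS leq_double.
  have in1 : xi1 \in vertices1.
    by have := m1.1; rewrite /vertices1; case: cid => vs /= ->.
  have in2 : xi2 \in vertices2.
    by have := m2.1; rewrite /vertices2; case: cid => vs /= ->.
  have [W1 [_ _ le1]] := worst_case_attained G1 y (sub_finite_set sV1.2 finV1) sV1.1.
  have [W2 [_ _ le2]] := worst_case_attained G2 y (sub_finite_set sV2.2 finV2) sV2.1.
  (* Were both maximizers already listed, the robust value at [y] could not exceed [J]; so one of
     them is new. *)
  have [V1xi|nV1] := pselect (V1 xi1); last first.
    by rewrite -addSn leq_add ?missing_lt ?missing_le.
  have [V2xi|nV2] := pselect (V2 xi2); last first.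
    by rewrite -addnS leq_add ?missing_lt ?missing_le.
  by move: lt; rewrite JE lte_fin; have := le1 _ V1xi; have := le2 _ V2xi; lra.
- move=> V1 V2 y J xi1 xi2 m1 m2 le [sV1 sV2 Yy JE ymin]; split; last by left.
  split=> // z Yz.
  rewrite /robust (worst_case_vertex m1) (worst_case_vertex m2).
  (* The robust value at [y] is at most the relaxed optimum, hence at most the relaxed value at [z],
     itself at most the robust value at [z]. *)
  move: le; rewrite JE lee_fin => le.
  have := ymin z Yz.
  have := worst_case_mono finV1 (maxG1 Yz) sV1.
  have := worst_case_mono finV2 (maxG2 Yz) sV2; lra.
Qed.

Let init_invariant e s : rs_init Y Xi1 Xi2 s -> invariant e s.
Proof.
move=> [xi1 [xi2 [c [v1 v2 ci ->]]]].
have sset (q : nat) (Xi : set 'cV[R]_q) xi : vertex Xi xi -> scenarios Xi [set xi].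
  by move=> vxi; split; [exists xi | move=> _ ->].
by split; [exact: sset | exact: sset | exact: cre_init_invariant].
Qed.

(** Nested induction on the three counters, passing each time to the tail of the run. *)
Let no_infinite_run e : 0 < e -> good e ->
  forall r : nat -> state, invariant e (r 0%N) ->
    ~ forall k, step e (r k) (r k.+1).
Proof.
move=> e0 ge r.
have [a] := ubnP (phase (r 0%N)); elim: a r => // a IHa r pa.
have [b] := ubnP (values_left (r 0%N)); elim: b r pa => // b IHb r pa vb.
have [c] := ubnP (slopes_left (r 0%N)); elim: c r pa vb => // c IHc r pa vb sc.
move=> inv run; have [inv1 dec] := step_invariant e0 ge inv (run 0%N).
pose r' k := r k.+1.
have run' k : step e (r' k) (r' k.+1) := run k.+1.
case: dec => [lt|[eqp [lt|[eqv lt]]]].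
- exact: (IHa r' (leq_trans lt pa)).
- by apply: (IHb r' _ (leq_trans lt vb)) => //; rewrite eqp.
- by apply: (IHc r' _ _ (leq_trans lt sc)) => //; rewrite ?eqp ?eqv.
Qed.

(** Passes and vertex maximizers exist by the invariant, and the comparison with [J] selects the
    next phase. *)
Let progress e s : invariant e s ->
  (exists s', step e s s') \/ exists y, s = Done y.
Proof.
case: s => [V1 V2 c|V1 V2 y J|y]; last by right; exists y.
  move=> [sV1 sV2 inv]; left.
  have [ybest [val [D [v pass]]]] :=
    cre_pass_exists (regG1 sV1.1 sV1.2) (regG2 sV2.1 sV2.2) inv.
  have [v0|v0] := eqVneq v 0; eexists.
    exact: explore_return pass v0.
  exact: explore_continue pass v0.
move=> [_ _ Yy _ _]; left.
have [y0 Yy0] := Y0; have [xi1 m1] := maxG1 Yy; have [xi2 m2] := maxG2 Yy.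
have [lt|ge] := ltP J (G1 y xi1 + G2 y xi2)%:E; eexists; last first.
  exact: assess_stop m1 m2 ge.
have c0 : cre_init Y (CreState y0 y0 +oo%E set0) by [].
exact: assess_continue m1 m2 lt c0.
Qed.

Let execution_invariant e K r : 0 < e -> good e ->
  finite_execution Y Xi1 Xi2 G1 G2 C1 C2 e K r -> invariant e (r K).
Proof.
move=> e0 ge [init run]; elim: K run => [_|K IHK run]; first exact: init_invariant.
have /IHK inv : forall k, (k < K)%N -> step e (r k) (r k.+1).
  by move=> k kK; apply: run; exact: ltnW.
by have [] := step_invariant e0 ge inv (run K (ltnSn K)).
Qed.

(** In this abstract form the areas enter only through convexity in [y], finitely many vertices,
    vertex maximizers and critical regions. *)
Lemma robust_scheduling_correct : for_small (fun eps =>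
  always_terminates Y Xi1 Xi2 G1 G2 C1 C2 eps /\
  forall ystar, may_terminate_with Y Xi1 Xi2 G1 G2 C1 C2 eps ystar ->
    is_minimizer Y robust ystar).
Proof.
apply: for_small_imp for_small_good => e e0 ge; split; first split.
- by move=> r [/(init_invariant e) inv run]; exact: no_infinite_run inv run.
- by move=> K r /(execution_invariant e0 ge)/progress.
- by move=> y [K [r [/(execution_invariant e0 ge) inv rK]]]; rewrite rK in inv.
Qed.

End Termination.

(** * Area values as functions of the tie-line point and the scenario *)

Section Area.
Variables (R : realType) (N n m m' l : nat) (A : area R n m m' l).
Variables (Y : set 'cV[R]_N).
Variables (own : 'cV[R]_N -> 'cV[R]_m) (other : 'cV[R]_N -> 'cV[R]_m').
Hypotheses (own_affine : forall u v (t : R),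
    own (t *: u + (1 - t) *: v) = t *: own u + (1 - t) *: own v)
  (other_affine : forall u v (t : R),
    other (t *: u + (1 - t) *: v) = t *: other u + (1 - t) *: other v).
Hypothesis feas : forall y xi, Y y -> uncertainty_set A xi ->
  exists x, feasible A (own y) (other y) xi x.
Hypothesis box : levec (xiL A) (xiU A).

Let J y xi := Jarea A (own y) (other y) xi.

Let comb_same q (v : 'cV[R]_q) (t : R) : t *: v + (1 - t) *: v = v.
Proof. by rewrite -scalerDl subrKC scale1r. Qed.

Lemma Jarea_convex_y xi : uncertainty_set A xi -> convex_on Y (J^~ xi).
Proof.
move=> Xxi u v t Yu Yv t0 t1; rewrite /J own_affine other_affine.
(* The fixed scenario is written as a mixture of itself so that joint convexity applies. *)
rewrite -{1}(comb_same xi t).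
by apply: Jarea_convex => //; exact: feas.
Qed.

Lemma Jarea_convex_xi y : Y y -> convex_on (uncertainty_set A) (J y).
Proof.
move=> Yy u v t Xu Xv t0 t1; rewrite /J.
rewrite -{1}(comb_same (own y) t) -{1}(comb_same (other y) t).
by apply: Jarea_convex => //; exact: feas.
Qed.

Lemma Jarea_vertex_maximizer y : Y y ->
  exists xi, vertex_maximizer (uncertainty_set A) J y xi.
Proof. by move=> Yy; exact: (box_vertex_max box (Jarea_convex_xi Yy)). Qed.

End Area.

(** * The tie-line set and the two-area problem *)

Lemma polyhedron_tie_set (R : realType) (m1 m2 l : nat) (T : tie R m1 m2 l) :
  polyhedron (tie_set T).
Proof.
(* [S] selects the slack angle, and [H] acts on the two stacked blocks of boundary angles. *)
pose S : 'M[R]_(1, m1 + m2) := delta_mx 0 (lshift m2 (slack T)).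
pose H : 'M[R]_(l, m1 + m2) := row_mx (H12 T) (H21 T).
have SE (y : 'cV[R]_(m1 + m2)) : S *m y = const_mx (usubmx y (slack T) 0).
  apply/matrixP => i j; rewrite !ord1 mxE (bigD1 (lshift m2 (slack T))) //= big1.
    by rewrite !mxE !eqxx /= mul1r addr0.
  by move=> k /negbTE kn; rewrite mxE kn andbF mul0r.
have -> : tie_set T = [set y | levec (H *m y) (f12 T)] `&`
    [set y | S *m y = 0] `&`
    [set y | levec (ymin T) (1%:M *m y)] `&` [set y | levec (1%:M *m y) (ymax T)].
  apply/seteqP; split=> y; rewrite /= !mul1mx SE -[y in H *m y]vsubmxK mul_row_col.
    move=> [? s0 ? ?]; do !split=> //.
    by apply/matrixP => i j; rewrite !mxE -[RHS]s0 mxE.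
  move=> [[[? /matrixP/(_ 0 0) s0] ?] ?]; split=> //.
  by move: s0; rewrite !mxE.
by repeat apply: polyhedronI; [exact: polyhedron_le | exact: polyhedron_eq |
  exact: polyhedron_ge | exact: polyhedron_le].
Qed.

Theorem theorem2 (R : realType) (n1 n2 m1 m2 l1 l2 l12 : nat)
    (A1 : area R n1 m1 m2 l1) (A2 : area R n2 m2 m1 l2) (T : tie R m1 m2 l12)
    (Y_nonempty : tie_set T !=set0)
    (box1 : levec (xiL A1) (xiU A1)) (box2 : levec (xiL A2) (xiU A2))
    (feasible1 : forall y xi, tie_set T y -> uncertainty_set A1 xi ->
       exists x, feasible A1 (usubmx y) (dsubmx y) xi x)
    (feasible2 : forall y xi, tie_set T y -> uncertainty_set A2 xi ->
       exists x, feasible A2 (dsubmx y) (usubmx y) xi x)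
    (C1 : set 'cV[R]_(n1 + (n1 + n1)) -> regions R (m1 + m2))
    (C2 : set 'cV[R]_(n2 + (n2 + n2)) -> regions R (m1 + m2))
    (regions1 : forall V, V !=set0 -> V `<=` vertex (uncertainty_set A1) ->
       critical_regions (tie_set T) (worst_case (J1 A1) V) (C1 V))
    (regions2 : forall V, V !=set0 -> V `<=` vertex (uncertainty_set A2) ->
       critical_regions (tie_set T) (worst_case (J2 A2) V) (C2 V)) :
  exists2 eps0 : R, 0 < eps0 & forall eps : R, 0 < eps -> eps <= eps0 ->
    always_terminates (tie_set T) (uncertainty_set A1) (uncertainty_set A2)
      (J1 A1) (J2 A2) C1 C2 eps /\
    forall ystar,
      may_terminate_with (tie_set T) (uncertainty_set A1) (uncertainty_set A2)
        (J1 A1) (J2 A2) C1 C2 eps ystar ->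
      is_minimizer (tie_set T)
        (fun y => worst_case (J1 A1) (uncertainty_set A1) y
                  + worst_case (J2 A2) (uncertainty_set A2) y) ystar.
Proof.
have usub_affine u v (t : R) : usubmx (t *: u + (1 - t) *: v : 'cV[R]_(m1 + m2)) =
    t *: usubmx u + (1 - t) *: usubmx v by apply/matrixP => i j; rewrite !mxE.
have dsub_affine u v (t : R) : dsubmx (t *: u + (1 - t) *: v : 'cV[R]_(m1 + m2)) =
    t *: dsubmx u + (1 - t) *: dsubmx v by apply/matrixP => i j; rewrite !mxE.
apply: robust_scheduling_correct => //.
- exact: polyhedron_tie_set.
- exact: finite_box_vertex.
- exact: finite_box_vertex.
- by move=> xi [Xxi _]; apply: (Jarea_convex_y (own := usubmx) (other := dsubmx)).
(* Area 2 reads the two blocks of [y] in the opposite order. *)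
- by move=> xi [Xxi _]; apply: (Jarea_convex_y (own := dsubmx) (other := usubmx)).
- exact: (Jarea_vertex_maximizer (own := usubmx) (other := dsubmx)).
- exact: (Jarea_vertex_maximizer (own := dsubmx) (other := usubmx)).
Qed.
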